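(* Let $(M,\omega)$ be a symplectic $G$-space, $*$ a $G$-invariant star product of Fedosov type on $M$, $\Phi_*$ a quantum moment map for $*$ with classical part $\Phi_0$, and $\{X_l\}_{l=1}^n$ a basis of $\mathfrak g$. For $\alpha^l=\sum_k\alpha^l_k\lambda^k\in\mathbb C[[\lambda]]$, the function $\exp_*(\Phi_*(\alpha^lX_l))$ (summation over $l$) is a product of $e^{\alpha_0^l\Phi_0(X_l)}$ and a polynomial of the $\alpha^l$ taking values in $C^\infty(M)[[\lambda]]$; that is, $\exp_*(\Phi_*(\alpha^lX_l))=e^{\alpha^l_0\Phi_0(X_l)}\sum_{j\ge0}\lambda^jP_j$ where each $P_j$ is a polynomial in the coefficients $\alpha^l_k$ with coefficients in $C^\infty(M)$.
   Context: Setting. $G$ is a Lie group with finite-dimensional real Lie algebra $\mathfrak g$, acting on $(M,\omega)$ by symplectomorphisms. $C^\infty(\cdot)$ means complex-valued smooth functions; $\lambda$ is a formal parameter. A star product on $M$ is an associative $\mathbb C[[\lambda]]$-bilinear product on $C^\infty(M)[[\lambda]]$ of the form $u*v=uv+\sum_{n\ge1}(\lambda/2)^nC_n(u,v)$, $C_n$ bidifferential operators annihilating constants, $C_1(u,v)-C_1(v,u)=2\{u,v\}$; it is $G$-invariant if $g(u*v)=gu*gv$, $(gu)(x)=u(g^{-1}x)$. Write $[a,b]_*=a*b-b*a$. $\mathfrak g_\lambda=\mathfrak g[[\lambda]]$ has the $\lambda$-bilinear bracket with $[\xi,\eta]_\lambda=\lambda[\xi,\eta]$ for $\xi,\eta\in\mathfrak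 g$. A quantum moment map for $*$ is a ($\mathbb C[[\lambda]]$-linear) homomorphism of associative algebras $\Phi_*:\mathfrak U(\mathfrak g_\lambda)\to(C^\infty(M)[[\lambda]],* )$ ($\mathfrak U$ the universal enveloping algebra) with $[\Phi_*(\xi),u]_*=\lambda\,\xi u$ for $\xi\in\mathfrak g$ ($\xi u$ the infinitesimal action); on $\alpha^lX_l$ it is evaluated by $\mathbb C[[\lambda]]$-linearity. For $\xi\in\mathfrak g$, $\Phi_*(\xi)=\Phi_0(\xi)+O(\lambda)$ with $\Phi_0$ the corresponding classical moment map. Fedosov type. The formal Weyl algebra $W_x$ ($x\in M$) consists of formal series $\sum\lambda^ka_{k,J}y^J$, $y$ linear coordinates on $T_xM$, with product $a\circ b=\sum_k(\lambda/2)^k\frac1{k!}\omega^{i_1j_1}\cdots\omega^{i_kj_k}\partial_{y^{i_1}}\cdots\partial_{y^{i_k}}a\;\partial_{y^{j_1}}\cdots\partial_{y^{j_k}}b$, filtered by $\deg y^j=1$, $\deg\lambda=2$; $\Gamma W$ denotes smooth sections of the resulting bundle $W\to M$. Given a torsion-free symplectic connection with induced covariant derivative $\partial$ on $\Gamma W$, a Fedosov connection is $Da=-\delta a+\partial a-\frac1\lambda[\gamma,a]$, $\delta a=dx^k\wedge\partial a/\partial y^k$, $\gamma\in\Gamma W\otimes\Lambda^1$, $\deg\gamma\ge3$, which is Abelian (its Weyl curvature is a scalar 2-form, so $D^2=0$). Let $W_D=\{a\in\Gamma W:Da=0\}$. The map $\sigma:W_D\to C^\infty(M)[[\lambda]]$,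 $\sigma(a)=a|_{y=0}$, is bijective with inverse $Q$. A star product is of Fedosov type if $a*b=\sigma(Q(a)\circ Q(b))$ for such a $D$. Star exponential. $\exp_*(\Phi_*(\xi))=\sigma\bigl(\sum_{k\ge0}\frac1{k!}Q(\Phi_*(\xi))^{\circ k}\bigr)\in C^\infty(M)[[\lambda]]$, where the series converges coefficientwise in $y^I\lambda^j$, absolutely and uniformly on compact sets, to an element of $W_D$. *)

(* Defs.v *)
(* Conventions used throughout.
   - A family attached to the charts of a manifold [M] (components of a tensor,
     Christoffel symbols, a section of the Weyl bundle, and so on) is a function
     of a chart [c] and a point [x : M]; it is meaningful only when [x] lies in
     the domain of [c], and every condition below is restricted to such points.
   - The matrix [omega c x] has the entries of omega = (1/2) omega_ij dx^i dx^j,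
     and the Poisson tensor omega^{ij} is its inverse matrix.  The opposite sign
     convention amounts to replacing omega by -omega.
   - C^oo(M)[[lambda]] consists of the sequences [u : nat -> M -> R[i]] of smooth
     functions, [u k] being the coefficient of lambda^k. *)
From HB Require Import structures.
From mathcomp Require Import all_boot all_order all_algebra.
From mathcomp Require Import all_classical all_reals all_analysis.
From mathcomp Require Export complex.

Set Implicit Arguments.
Unset Strict Implicit.
Unset Printing Implicit Defensive.

Import Order.TTheory GRing.Theory Num.Theory numFieldNormedType.Exports.
Local Open Scope classical_set_scope.
Local Open Scope ring_scope.
Local Open Scope complex_scope.

Definition fps (K : comNzRingType) : Type := nat -> K.

Section FormalPowerSeries.
Variable K : comNzRingType.
Implicit Types a b c : fps K.

HB.instance Definition _ := GRing.Zmodule.copy (fps K) (nat -> K).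

Definition fps_one : fps K := fun n => (n == 0%N)%:R.
Definition fps_mul a b : fps K := fun n => \sum_(i < n.+1) a i * b (n - i)%N.

Let trunc m a : {poly K} := \poly_(i < m.+1) a i.

Let fps_mulE m a b n : (n <= m)%N -> fps_mul a b n = (trunc m a * trunc m b)`_n.
Proof.
move=> nm; rewrite coefM; apply: eq_bigr => i _.
by rewrite !coef_poly !ltnS (leq_trans (leq_ord i) nm) (leq_trans (leq_subr _ _) nm).
Qed.

Let fps_mulA : associative fps_mul.
Proof.
move=> a b c; apply/funext => n; pose T := trunc n.
transitivity ((T a * (T b * T c))`_n); last first.
  rewrite mulrA coefM; apply: eq_bigr => i _.
  by rewrite -fps_mulE ?leq_ord // coef_poly ltnS leq_subr.
rewrite coefM; apply: eq_bigr => i _.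
by rewrite -fps_mulE ?leq_subr // coef_poly ltnS leq_ord.
Qed.

Let fps_mulC : commutative fps_mul.
Proof. by move=> a b; apply/funext => n; rewrite !(@fps_mulE n) // mulrC. Qed.

Let fps_mul1 : left_id fps_one fps_mul.
Proof.
move=> a; apply/funext => n; rewrite /fps_mul big_ord_recl subn0 mul1r big1 ?addr0 //.
by move=> i _; rewrite mul0r.
Qed.

Let fps_mulDl : left_distributive fps_mul +%R.
Proof.
move=> a b c; apply/funext => n.
rewrite -[RHS]/(fps_mul a c n + fps_mul b c n) /fps_mul -big_split /=.
by apply: eq_bigr => i _; rewrite mulrDl.
Qed.

Let fps_one_neq0 : fps_one != 0.
Proof. by apply/eqP => /(congr1 (@^~ 0%N)) /eqP; rewrite oner_eq0. Qed.

HB.instance Definition _ := GRing.Zmodule_isComNzRing.Build (fps K)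
  fps_mulA fps_mulC fps_mul1 fps_mulDl fps_one_neq0.

Definition fps_const (z : K) : fps K := fun n => if n is 0%N then z else 0.
Definition fps_var : fps K := fun n => (n == 1%N)%:R.

End FormalPowerSeries.

Section Smooth.
Context {R : realType} {d : nat}.

Definition partial (i : 'I_d) (f : 'rV[R]_d -> R) : 'rV[R]_d -> R :=
  fun v => 'D_(delta_mx 0 i) f v.

(* All iterated partial derivatives exist and are continuous on [U]. *)
Definition smooth_on (U : set 'rV[R]_d) (f : 'rV[R]_d -> R) : Prop :=
  forall (s : seq 'I_d) (v : 'rV[R]_d), U v ->
    {for v, continuous (foldr partial f s)} /\
    forall i, derivable (foldr partial f s) v (delta_mx 0 i).

Definition dirC (f : 'rV[R]_d -> R[i]) (h v : 'rV[R]_d) : R[i] :=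
  'D_h (fun w => complex.Re (f w)) v +i* 'D_h (fun w => complex.Im (f w)) v.

End Smooth.

(* [chart_inv c] inverts [chart_map c] on [chart_dom c] and is arbitrary
   elsewhere. *)
Record manifold (R : realType) (d : nat) := Manifold {
  msort :> topologicalType;
  m_hausdorff : hausdorff_space msort;
  m_second_countable : @second_countable msort;
  chart : Type;
  chart_dom : chart -> set msort;
  chart_map : chart -> msort -> 'rV[R]_d;
  chart_inv : chart -> 'rV[R]_d -> msort;
  chart_at : msort -> chart;
  chart_atP : forall x, chart_dom (chart_at x) x;
  chart_dom_open : forall c, open (chart_dom c);
  chart_img_open : forall c, open (chart_map c @` chart_dom c);
  chart_mapK : forall c x, chart_dom c x -> chart_inv c (chart_map c x) = x;
  chart_map_cont : forall c, {within chart_dom c, continuous (chart_map c)};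
  chart_inv_cont : forall c,
    {within chart_map c @` chart_dom c, continuous (chart_inv c)};
  chart_trans : forall c c' k,
    smooth_on (chart_map c @` (chart_dom c `&` chart_dom c'))
              (fun v => chart_map c' (chart_inv c v) 0 k)
}.

Section Maps.
Context {R : realType} {d1 d2 d3 : nat}.
Variables (M1 : manifold R d1) (M2 : manifold R d2) (M3 : manifold R d3).

Definition smooth_map (f : M1 -> M2) : Prop :=
  continuous f /\
  forall (c : chart M1) (c' : chart M2) k,
    smooth_on (chart_map c @` [set x | chart_dom c x /\ chart_dom c' (f x)])
              (fun v => chart_map c' (f (chart_inv c v)) 0 k).

(* Smoothness of a map on the product manifold, in the product charts. *)
Definition smooth_map2 (f : M1 -> M2 -> M3) : Prop :=
  continuous (fun p : M1 * M2 => f p.1 p.2) /\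
  forall (a : chart M1) (b : chart M2) (c : chart M3) k,
    smooth_on
      [set w : 'rV[R]_(d1 + d2) | exists x y,
         [/\ chart_dom a x, chart_dom b y, chart_dom c (f x y)
           & w = row_mx (chart_map a x) (chart_map b y)]]
      (fun w => chart_map c (f (chart_inv a (lsubmx w))
                               (chart_inv b (rsubmx w))) 0 k).

(* Entry (i, k) is the derivative of the k-th coordinate of [f] in the direction
   of the i-th coordinate: tangent vectors are row vectors and the differential
   acts by multiplication on the right. *)
Definition jacobian (f : M1 -> M2) (c : chart M1) (c' : chart M2) (x : M1) :
    'M[R]_(d1, d2) :=
  \matrix_(i, k) partial i (fun v => chart_map c' (f (chart_inv c v)) 0 k)
                           (chart_map c x).

End Maps.

Section Functions.
Context {R : realType} {d : nat}.
Variable M : manifold R d.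

Definition smooth_in (c : chart M) (f : M -> R) : Prop :=
  smooth_on (chart_map c @` chart_dom c) (f \o chart_inv c).

Definition smoothC_in (c : chart M) (f : M -> R[i]) : Prop :=
  smooth_in c (fun x => complex.Re (f x)) /\ smooth_in c (fun x => complex.Im (f x)).

Definition smoothC (f : M -> R[i]) : Prop := forall c, smoothC_in c f.

Definition pd (c : chart M) (i : 'I_d) (f : M -> R) : M -> R :=
  fun x => partial i (f \o chart_inv c) (chart_map c x).

Definition pdC (c : chart M) (i : 'I_d) (f : M -> R[i]) : M -> R[i] :=
  fun x => dirC (f \o chart_inv c) (delta_mx 0 i) (chart_map c x).

Definition formal_fun := nat -> M -> R[i].

Definition formal_smooth (u : formal_fun) : Prop := forall k, smoothC (u k).

Definition formal_add (u v : formal_fun) : formal_fun := fun k x => u k x + v k x.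

Definition formal_one : formal_fun := fun k _ => (k == 0%N)%:R.

Definition formal_scale (z : fps R[i]) (u : formal_fun) : formal_fun :=
  fun k x => \sum_(i < k.+1) z i * u (k - i)%N x.

End Functions.

Section Symplectic.
Context {R : realType} {d : nat}.
Variables (M : manifold R d) (omega : chart M -> M -> 'M[R]_d).

Definition symplectic_form : Prop :=
  [/\ forall c i j, smooth_in c (fun x => omega c x i j),
      forall c c' x, chart_dom c x -> chart_dom c' x ->
        omega c x = jacobian idfun c c' x *m omega c' x *m (jacobian idfun c c' x)^T,
      forall c x i j, chart_dom c x -> omega c x i j = - omega c x j i,
      forall c x, chart_dom c x -> omega c x \in unitmx
    & forall c x i j k, chart_dom c x ->
        pd c i (fun z => omega c z j k) x + pd c j (fun z => omega c z k i) x
          + pd c k (fun z => omega c z i j) x = 0].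

Definition poisson_tensor (c : chart M) (x : M) : 'M[R]_d := invmx (omega c x).

Definition poisson_bracket (u v : M -> R[i]) : M -> R[i] := fun x =>
  \sum_i \sum_j (poisson_tensor (chart_at x) x i j)%:C
                * pdC (chart_at x) i u x * pdC (chart_at x) j v x.

(* The multi-indices [I] are functions on 'I_d, with entries bounded by the order. *)
Definition pdC_multi (c : chart M) (N : nat) (I : {ffun 'I_d -> 'I_N.+1})
    (u : M -> R[i]) : M -> R[i] :=
  foldr (fun i w => iter (I i) (pdC c i) w) u (enum 'I_d).

Definition bidifferential (B : (M -> R[i]) -> (M -> R[i]) -> M -> R[i]) : Prop :=
  exists N : nat, forall c : chart M,
  exists b : {ffun 'I_d -> 'I_N.+1} -> {ffun 'I_d -> 'I_N.+1} -> M -> R[i],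
    (forall I J, smoothC_in c (b I J)) /\
    forall u v x, smoothC u -> smoothC v -> chart_dom c x ->
      B u v x = \sum_I \sum_J b I J x * pdC_multi c I u x * pdC_multi c J v x.

(* u * v = sum_n (lambda/2)^n C_n(u, v), extended lambda-bilinearly. *)
Definition star (C : nat -> (M -> R[i]) -> (M -> R[i]) -> M -> R[i])
    (u v : formal_fun M) : formal_fun M := fun m x =>
  \sum_(n < m.+1) \sum_(i < (m - n).+1)
     (2%:R ^+ n)^-1 * C n (u i) (v (m - n - i)%N) x.

Definition star_product (C : nat -> (M -> R[i]) -> (M -> R[i]) -> M -> R[i]) : Prop :=
  [/\ forall u v x, smoothC u -> smoothC v -> C 0%N u v x = u x * v x,
      forall n, (0 < n)%N -> bidifferential (C n),
      forall n (z : R[i]) u x, (0 < n)%N -> smoothC u ->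
        C n (fun _ => z) u x = 0 /\ C n u (fun _ => z) x = 0,
      forall u v x, smoothC u -> smoothC v ->
        C 1%N u v x - C 1%N v u x = 2%:R * poisson_bracket u v x
    & forall u v w k x, formal_smooth u -> formal_smooth v -> formal_smooth w ->
        star C (star C u v) w k x = star C u (star C v w) k x].

End Symplectic.

Record lie_group (R : realType) (n : nat) := LieGroup {
  lg_mfd :> manifold R n;
  lg_mul : lg_mfd -> lg_mfd -> lg_mfd;
  lg_one : lg_mfd;
  lg_inv : lg_mfd -> lg_mfd;
  lg_mulA : associative lg_mul;
  lg_mul1g : left_id lg_one lg_mul;
  lg_mulVg : left_inverse lg_one lg_inv lg_mul;
  lg_mul_smooth : smooth_map2 lg_mul;
  lg_inv_smooth : smooth_map lg_inv
}.

(* The Lie algebra is the tangent space at the unit, written in the chart there: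
   its elements are row vectors. *)
Section LieAlgebra.
Context {R : realType} {n : nat}.
Variable G : lie_group R n.

Local Notation e := (lg_one G).
Local Notation ce := (chart_at e).

Definition left_field (xi : 'rV[R]_n) (f : G -> R) : G -> R :=
  fun g => 'D_xi (fun v => f (lg_mul g (chart_inv ce v))) (chart_map ce e).

(* Value at the unit of the bracket of the left-invariant vector fields. *)
Definition lie_bracket (xi eta : 'rV[R]_n) : 'rV[R]_n :=
  \row_k (left_field xi (left_field eta (fun g => chart_map ce g 0 k)) e
          - left_field eta (left_field xi (fun g => chart_map ce g 0 k)) e).

(* g_lambda = g[[lambda]] with complex scalars, in the coordinates of the
   tangent space at the unit. *)
Definition glambda : Type := 'rV[fps R[i]]_n.

HB.instance Definition _ := GRing.Lmodule.on glambda.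

Definition glambda_of (xi : 'rV[R]_n) : glambda :=
  map_mx (fun r : R => fps_const r%:C) xi.

Definition glambda_bracket (a b : glambda) : glambda :=
  \sum_i \sum_j (a 0 i * b 0 j * fps_var R[i])
                *: glambda_of (lie_bracket (delta_mx 0 i) (delta_mx 0 j)).

Definition lie_morphism (A : algType (fps R[i])) (f : glambda -> A) : Prop :=
  forall a b, f (glambda_bracket a b) = f a * f b - f b * f a.

Definition universal_enveloping (U : algType (fps R[i]))
    (iota : {linear glambda -> U}) : Prop :=
  lie_morphism iota /\
  forall (A : algType (fps R[i])) (f : {linear glambda -> A}), lie_morphism f ->
    exists h : {lrmorphism U -> A}, (forall a, h (iota a) = f a) /\
      forall h' : {lrmorphism U -> A}, (forall a, h' (iota a) = f a) -> h' =1 h.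

Section Action.
Context {d : nat} (M : manifold R d) (omega : chart M -> M -> 'M[R]_d).
Variable act : G -> M -> M.

Definition symplectic_action : Prop :=
  [/\ smooth_map2 act,
      forall x, act e x = x,
      forall g h x, act (lg_mul g h) x = act g (act h x)
    & forall g c c' x, chart_dom c x -> chart_dom c' (act g x) ->
        omega c x = jacobian (act g) c c' x *m omega c' (act g x)
                      *m (jacobian (act g) c c' x)^T].

Definition fun_act (g : G) (u : M -> R[i]) : M -> R[i] :=
  fun x => u (act (lg_inv g) x).

(* Derivative of g |-> g u at the unit in the direction [xi]. *)
Definition inf_act (xi : 'rV[R]_n) (u : M -> R[i]) : M -> R[i] :=
  fun x => dirC (fun v => fun_act (chart_inv ce v) u x) xi (chart_map ce e).

Variable C : nat -> (M -> R[i]) -> (M -> R[i]) -> M -> R[i].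

Definition invariant_star : Prop :=
  forall g (u v : formal_fun M) k x, formal_smooth u -> formal_smooth v ->
    fun_act g (star C u v k) x
      = star C (fun j => fun_act g (u j)) (fun j => fun_act g (v j)) k x.

Definition quantum_moment_map (U : algType (fps R[i]))
    (iota : glambda -> U) (Phi : U -> formal_fun M) : Prop :=
  [/\ forall a, formal_smooth (Phi a),
      (forall a b, Phi (a + b) = formal_add (Phi a) (Phi b))
        /\ (forall z a, Phi (z *: a) = formal_scale z (Phi a)),
      Phi 1 = formal_one (M := M),
      forall a b, Phi (a * b) = star C (Phi a) (Phi b)
    & forall xi (u : formal_fun M) k x, formal_smooth u ->
        star C (Phi (iota (glambda_of xi))) u k x
          - star C u (Phi (iota (glambda_of xi))) k x
        = if k is k'.+1 then inf_act xi (u k') x else 0].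

End Action.
End LieAlgebra.
Arguments glambda : clear implicits.

Section WeylAlgebra.
Context {R : realType} {d : nat}.

Definition mindex := {ffun 'I_d -> nat}.
Definition mdeg (J : mindex) : nat := \sum_i J i.
Definition mnat N (J : {ffun 'I_d -> 'I_N}) : mindex := [ffun i => J i : nat].

(* Formal series in y, and in (lambda, y): [a k J] is the coefficient of
   lambda^k y^J. *)
Definition yseries := mindex -> R[i].
Definition weyl := nat -> yseries.

Definition yconst (z : R[i]) : yseries := fun J => if mdeg J == 0%N then z else 0.

Definition ydiff (i : 'I_d) (p : yseries) : yseries :=
  fun J => (J i).+1%:R * p [ffun j => (J j + (j == i))%N].

Definition ytimes (i : 'I_d) (p : yseries) : yseries :=
  fun J => if (0 < J i)%N then p [ffun j => (J j - (j == i))%N] else 0.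

Definition ymul (p q : yseries) : yseries := fun J =>
  \sum_(I : {ffun 'I_d -> 'I_(mdeg J).+1} | [forall i, (I i <= J i)%N])
     p (mnat I) * q [ffun i => (J i - I i)%N].

(* The homogeneous part of degree [m] as a polynomial function of y. *)
Definition yeval (m : nat) (p : yseries) (y : 'rV[R]_d) : R[i] :=
  \sum_(J : {ffun 'I_d -> 'I_m.+1} | mdeg (mnat J) == m)
     p (mnat J) * \prod_i (y 0 i ^+ J i)%:C.

Definition wadd (a b : weyl) : weyl := fun k J => a k J + b k J.
Definition wsub (a b : weyl) : weyl := fun k J => a k J - b k J.
Definition wone : weyl := fun k => if k is 0%N then yconst 1 else fun _ => 0.

(* Division by lambda, for series without term of order 0 in lambda. *)
Definition wdivlambda (a : weyl) : weyl := fun k => a k.+1.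

Variable P : 'M[R]_d.

Definition wmul (a b : weyl) : weyl := fun k J =>
  \sum_(n < k.+1) \sum_(l < (k - n).+1)
     (2%:R ^+ n * n`!%:R)^-1 *
     \sum_(s : n.-tuple 'I_d) \sum_(t : n.-tuple 'I_d)
        (\prod_(r < n) P (tnth s r) (tnth t r))%:C *
        ymul (foldr ydiff (a l) s) (foldr ydiff (b (k - n - l)%N) t) J.

Definition wcomm (a b : weyl) : weyl := wsub (wmul a b) (wmul b a).

Definition wpow (a : weyl) (m : nat) : weyl := iter m (wmul a) wone.

End WeylAlgebra.
Arguments mindex : clear implicits.
Arguments yseries : clear implicits.
Arguments weyl : clear implicits.

Section Fedosov.
Context {R : realType} {d : nat}.
Variables (M : manifold R d) (omega : chart M -> M -> 'M[R]_d).

Local Notation W := (weyl R d).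

(* The coordinates y of chart [c] are those of tangent vectors, so that they
   transform by the Jacobian matrix. *)
Definition wsection := chart M -> M -> W.

Definition smooth_wsection (a : wsection) : Prop :=
  (forall c k J, smoothC_in c (fun x => a c x k J)) /\
  (forall c c' x k m y, chart_dom c x -> chart_dom c' x ->
     yeval m (a c x k) y = yeval m (a c' x k) (y *m jacobian idfun c c' x)).

Definition woneform := chart M -> M -> 'I_d -> W.

Definition smooth_woneform (b : woneform) : Prop :=
  (forall c i k J, smoothC_in c (fun x => b c x i k J)) /\
  (forall c c' x i k m y, chart_dom c x -> chart_dom c' x ->
     yeval m (b c x i k) y
     = \sum_j (jacobian idfun c c' x i j)%:C
              * yeval m (b c' x j k) (y *m jacobian idfun c c' x)).

(* [Gamma c x k i j] is the Christoffel symbol Gamma^k_ij. *)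
Definition christoffel := chart M -> M -> 'I_d -> 'I_d -> 'I_d -> R.

Definition symplectic_connection (Gamma : christoffel) : Prop :=
  [/\ forall c k i j, smooth_in c (fun x => Gamma c x k i j),
      forall c c' x m i j, chart_dom c x -> chart_dom c' x ->
        \sum_k Gamma c x k i j * jacobian idfun c c' x k m
        = pd c i (pd c j (fun z => chart_map c' z 0 m)) x
          + \sum_k \sum_l Gamma c' x m k l
              * jacobian idfun c c' x i k * jacobian idfun c c' x j l,
      forall c x k i j, chart_dom c x -> Gamma c x k i j = Gamma c x k j i
    & forall c x i j k, chart_dom c x ->
        pd c i (fun z => omega c z j k) x
        = \sum_l (Gamma c x l i j * omega c x l k + Gamma c x l i k * omega c x j l)].

Variables (Gamma : christoffel) (gamma : woneform).

Local Notation comm c x := (wcomm (poisson_tensor omega c x)).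

(* Component i of the induced covariant derivative,
   d_i a - Gamma^k_ij y^j da/dy^k. *)
Definition wcov (a : chart M -> M -> W) (c : chart M) (x : M) (i : 'I_d) : W :=
  fun k J => pdC c i (fun z => a c z k J) x
    - \sum_l \sum_j (Gamma c x l i j)%:C * ytimes j (ydiff l (a c x k)) J.

(* Component i of D a = - delta a + d a - (1/lambda) [gamma, a]. *)
Definition fedosov_D (a : wsection) (c : chart M) (x : M) (i : 'I_d) : W :=
  fun k J => - ydiff i (a c x k) J + wcov a c x i k J
             - wdivlambda (comm c x (gamma c x i) (a c x)) k J.

(* [riemann c x k l i j] is R^k_lij, the covariant derivatives d_i satisfying
   (d_i d_j - d_j d_i) y^k = - R^k_lij y^l. *)
Definition riemann (c : chart M) (x : M) (k l i j : 'I_d) : R :=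
  pd c i (fun z => Gamma c z k j l) x - pd c j (fun z => Gamma c z k i l) x
  + \sum_m (Gamma c x k i m * Gamma c x m j l - Gamma c x k j m * Gamma c x m i l).

(* (1/2) omega_km R^k_lij y^m y^l, whose commutator gives the square of the
   covariant derivative: d^2 a = - (1/lambda) [R, a]. *)
Definition wriemann (c : chart M) (x : M) (i j : 'I_d) : W := fun p J =>
  \sum_k \sum_l \sum_m (2%:R^-1 * omega c x k m * riemann c x k l i j)%:C
     * ytimes m (ytimes l (wone p)) J.

(* omega_ij y^j dx^i + gamma: since (1/lambda) [omega_ij y^j dx^i, a] = delta a,
   D = d - (1/lambda) [full_form, -]. *)
Definition full_form : woneform := fun c x i =>
  wadd (fun p J => \sum_j (omega c x i j)%:C * ytimes j (wone p) J) (gamma c x i).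

(* The components of R + d r - (1/lambda) r o r for r = full_form, so that
   D^2 a = - (1/lambda) [weyl_curvature, a]. *)
Definition weyl_curvature (c : chart M) (x : M) (i j : 'I_d) : W :=
  let r i' c' z := full_form c' z i' in
  wsub (wadd (wriemann c x i j)
             (wsub (wcov (r j) c x i) (wcov (r i) c x j)))
       (wdivlambda (comm c x (full_form c x i) (full_form c x j))).

Definition abelian_connection : Prop :=
  forall c x i j k J, chart_dom c x -> mdeg J != 0%N ->
    weyl_curvature c x i j k J = 0.

Definition fedosov_connection : Prop :=
  [/\ symplectic_connection Gamma, smooth_woneform gamma,
      forall c x i k J, chart_dom c x -> (2 * k + mdeg J < 3)%N -> gamma c x i k J = 0
    & abelian_connection].

(* The elements of W_D. *)
Definition flat_wsection (a : wsection) : Prop :=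
  smooth_wsection a /\
  forall c x i k J, chart_dom c x -> fedosov_D a c x i k J = 0.

Definition sigma (a : wsection) : formal_fun M :=
  fun k x => a (chart_at x) x k [ffun => 0%N].

(* [Q] is the inverse of the bijection sigma : W_D -> C^oo(M)[[lambda]]. *)
Definition inverse_sigma (Q : formal_fun M -> wsection) : Prop :=
  (forall u, formal_smooth u -> flat_wsection (Q u) /\ sigma (Q u) = u) /\
  (forall a, flat_wsection a ->
     formal_smooth (sigma a) /\
     forall c x, chart_dom c x -> Q (sigma a) c x = a c x).

Definition wsection_mul (a b : wsection) : wsection :=
  fun c x => wmul (poisson_tensor omega c x) (a c x) (b c x).

Definition fedosov_type (Q : formal_fun M -> wsection)
    (C : nat -> (M -> R[i]) -> (M -> R[i]) -> M -> R[i]) : Prop :=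
  [/\ fedosov_connection, inverse_sigma Q
    & forall u v k x, formal_smooth u -> formal_smooth v ->
        star C u v k x = sigma (wsection_mul (Q u) (Q v)) k x].

End Fedosov.

Section StarExp.
Context {R : realType} {d : nat}.
Variables (M : manifold R d) (omega : chart M -> M -> 'M[R]_d).

Definition cexp (z : R[i]) : R[i] :=
  limn (fun N => \sum_(m < N) (z ^+ m / m`!%:R : R[i]^o)).

(* Partial sums of the exponential series of a section, coefficientwise. *)
Definition wexp_sum (a : wsection M) (c : chart M) (x : M) (k : nat)
    (J : mindex d) : nat -> R[i]^o :=
  fun N => \sum_(m < N) (m`!%:R)^-1 * wpow (poisson_tensor omega c x) (a c x) m k J.

Definition wexp (a : wsection M) : wsection M :=
  fun c x k J => limn (wexp_sum a c x k J).

Definition star_exp (Q : formal_fun M -> wsection M) (u : formal_fun M) :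
    formal_fun M := sigma (wexp (Q u)).

(* A polynomial in the variables alpha^l_k (indexed by the pairs (l, k)), with
   functions on [M] as coefficients: the list of its terms, a monomial being
   the list of its variables. *)
Definition fun_poly (n : nat) := seq ((M -> R[i]) * seq ('I_n * nat)).

Definition smooth_fun_poly n (p : fun_poly n) : Prop :=
  forall t, t \in p -> smoothC t.1.

Definition fun_poly_eval n (p : fun_poly n) (alpha : 'I_n -> fps R[i]) (x : M) : R[i] :=
  \sum_(t <- p) t.1 x * \prod_(lk <- t.2) alpha lk.1 lk.2.

End StarExp.

(* Main.v *)
(** At a point of [M] the Weyl product preserves the degree 2 deg(lambda) + deg(y).
   Write a flat section as [z + a], with [z] its coefficient of lambda^0 y^0: since
   [z] is central and [a] has positive degree, exp(z + a) = e^z exp(a), and each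
   coefficient of exp(a) is a finite sum.  The map [Q] is C[[lambda]]-linear, because
   flat sections are closed under multiplication by formal series (the commutator with
   [gamma] vanishes at lambda = 0); so the components of [Q (PhiX alpha)] are linear
   in the coefficients of [alpha], and those of exp(a) are polynomials in them.  Their
   coefficients are Weyl products of globally defined sections, hence global smooth
   functions at y = 0; this is the invariance of the Weyl product under changes of
   charts. *)
Require Import Defs.
From mathcomp Require Import all_boot all_order all_algebra.
From mathcomp Require Import all_classical all_reals all_analysis.
From mathcomp Require Import complex ring zify.
Import Order.TTheory GRing.Theory Num.Theory numFieldNormedType.Exports.
Local Open Scope classical_set_scope.
Local Open Scope ring_scope.

Set Implicit Arguments.
Unset Strict Implicit.
Unset Printing Implicit Defensive.

(** * Smooth functions in a chart *)

(** The delicate point is that the value at [y = 0] of a Weyl product does not depend on the chart.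
    Charts are compared through the polynomial functions [yeval], whereas [wmul] acts on
    coefficients through derivatives, and expanding [p' (yA)] in coefficients would be unwieldy. The
    relation [p (y) = p' (yA)] is therefore recast as [ycov]: all iterated derivatives at 0 agree,
    the chain rule turning [ydiff i] into the combination of the [ydiff j] with coefficients
    [A i j]. Contractions with [P] become contractions with [A^T P A], which is how the Poisson
    tensor transforms.

    The other choice is to fix the order [K] in lambda first. A product of [m] factors of positive
    degree reaches lambda^K y^0 only if [m <= 2 K], and [alpha l i] reaches it only if [i <= K]; so
    one finite list of monomials serves for all [alpha]. Powers are iterated left multiplications,
    and left multiplication by [z + a] is [z] plus left multiplication by [a], so the binomial
    formula is that of two commuting operators. *)

Section SmoothOn.
Context {R : realType} {d : nat}.
Implicit Types (U : set 'rV[R]_d) (f g : 'rV[R]_d -> R).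

(** The lists of [smooth_on] have the outermost derivative at their head; this recursion takes the
    innermost one first, so that closure properties follow from the Leibniz rule by induction on the
    order. *)
Fixpoint smooth_upto (n : nat) U f : Prop :=
  (forall v, U v -> {for v, continuous f} /\
     forall i, derivable f v (delta_mx 0 i)) /\
  if n is n'.+1 then forall i, smooth_upto n' U (partial i f) else True.

Lemma smooth_onP U f : smooth_on U f <-> forall n, smooth_upto n U f.
Proof.
split=> [fU n|fU s]; last first.
  elim/last_ind: s f fU => [|s i IHs] f fU v Uv; first exact: (fU 0%N).1.
  rewrite foldr_rcons; apply: IHs => // n.
  exact: (fU n.+1).2.
elim: n f fU => [|n IHn] f fU; first by split=> // v /(fU [::]).
split=> [v /(fU [::])//|i]; apply: IHn => s v Uv.
by have := fU (rcons s i) v Uv; rewrite foldr_rcons.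
Qed.

Lemma smooth_upto_le n m U f : (m <= n)%N -> smooth_upto n U f -> smooth_upto m U f.
Proof.
elim: m n f => [|m IHm] [|n] f // mn [f0 fS]; split=> // i.
by apply: (IHm n) => //; exact: fS.
Qed.

Lemma eq_on_near U f g v : open U -> (forall w, U w -> f w = g w) -> U v ->
  \near v, f v = g v.
Proof.
by move=> oU fg Uv; near=> w; apply: fg; near: w; exact: open_nbhs_nbhs.
Unshelve. all: by end_near. Qed.

(** Formulas for derivatives hold only on [U]; since derivatives are local and [U] is open, they can
    be differentiated again. *)
Lemma smooth_upto_eq n U f g : open U -> (forall v, U v -> f v = g v) ->
  smooth_upto n U f -> smooth_upto n U g.
Proof.
move=> oU; elim: n f g => [|n IHn] f g fg [f0 fS]; (split; last 1 first);
  [exact: I | | move=> i; apply: IHn (fS i) => v Uv | ].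
2: by apply: near_eq_derive; exact: eq_on_near Uv.
all: move=> v Uv; have [cf df] := f0 v Uv; have nfg := eq_on_near oU fg Uv.
all: split=> [|i]; last exact: near_eq_derivable (df i).
all: rewrite /prop_for /continuous_at -(fg _ Uv).
all: exact: cvg_trans (near_eq_cvg nfg) cf.
Qed.

Lemma smooth_upto_cst n U (r : R) : smooth_upto n U (cst r).
Proof.
elim: n r => [|n IHn] r; (split; last 1 first); [exact: I | | move=> i | ].
2: by rewrite (_ : partial _ _ = cst 0) //; apply/funext => v; exact: derive_cst.
all: by move=> v _; split=> [|i]; [exact: cst_continuous | exact: derivable_cst].
Qed.

Lemma smooth_uptoD n U f g : open U ->
  smooth_upto n U f -> smooth_upto n U g -> smooth_upto n U (f + g).
Proof.
move=> oU; elim: n f g => [|n IHn] f g [f0 fS] [g0 gS]; (split; last 1 first);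
  [exact: I | | move=> i | ].
2: apply: (smooth_upto_eq oU _ (IHn _ _ (fS i) (gS i))) => v Uv.
2: by rewrite /partial deriveD; [ | exact: (f0 v Uv).2 | exact: (g0 v Uv).2].
all: move=> v Uv; have [cf df] := f0 v Uv; have [cg dg] := g0 v Uv.
all: by split=> [|i]; [exact: continuousD | exact: derivableD].
Qed.

Lemma smooth_uptoM n U f g : open U ->
  smooth_upto n U f -> smooth_upto n U g -> smooth_upto n U (f * g).
Proof.
move=> oU; elim: n f g => [|n IHn] f g; last first.
  move=> fU gU; have [f0 fS] := fU; have [g0 gS] := gU; split=> [v Uv|i].
    have [cf df] := f0 v Uv; have [cg dg] := g0 v Uv.
    by split=> [|i]; [exact: continuousM | exact: derivableM].
  have := smooth_uptoD oU
    (IHn _ _ (smooth_upto_le (leqnSn n) fU) (gS i))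
    (IHn _ _ (smooth_upto_le (leqnSn n) gU) (fS i)).
  apply: smooth_upto_eq => // v Uv.
  by rewrite /partial deriveM; [ |exact: (f0 v Uv).2 | exact: (g0 v Uv).2].
move=> [f0 _] [g0 _]; split; [move=> v Uv | exact: I].
have [cf df] := f0 v Uv; have [cg dg] := g0 v Uv.
by split=> [|i]; [exact: continuousM | exact: derivableM].
Qed.

(** The derivative of [1 / f] is a product of [1 / f] twice, [f'] and a constant, so the induction
    is on the order with [f] fixed. *)
Lemma smooth_uptoV n U f : open U -> (forall v, U v -> f v != 0) ->
  smooth_upto n U f -> smooth_upto n U (fun v => (f v)^-1).
Proof.
move=> oU fN0; elim: n => [|n IHn].
  move=> [f0 _]; split; [move=> v Uv | exact: I]; have [cf df] := f0 v Uv.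
  by split=> [|i]; [exact: continuousV (fN0 v Uv) cf | exact: derivableV (fN0 v Uv) (df i)].
move=> fU; have [f0 fS] := fU; split=> [v Uv|i].
  have [cf df] := f0 v Uv.
  by split=> [|i]; [exact: continuousV (fN0 v Uv) cf | exact: derivableV (fN0 v Uv) (df i)].
have fV := IHn (smooth_upto_le (leqnSn n) fU).
have := smooth_uptoM oU (smooth_uptoM oU (smooth_upto_cst n U (-1)) (smooth_uptoM oU fV fV)) (fS i).
apply: smooth_upto_eq => // v Uv.
rewrite /partial deriveV; first last; [exact: (f0 v Uv).2 | exact: fN0 | idtac].
by rewrite -exprVn expr2 -[LHS]/(-1 * ((f v)^-1 * (f v)^-1) * _) mulN1r.
Qed.

Lemma smooth_on_eq U f g : open U -> (forall v, U v -> f v = g v) ->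
  smooth_on U f -> smooth_on U g.
Proof.
move=> oU fg /smooth_onP fU; apply/smooth_onP => n.
exact: smooth_upto_eq fg (fU n).
Qed.

Lemma smooth_on_cst U (r : R) : smooth_on U (fun=> r).
Proof. by apply/smooth_onP => n; exact: smooth_upto_cst. Qed.

Lemma smooth_onD U f g : open U -> smooth_on U f -> smooth_on U g ->
  smooth_on U (fun v => f v + g v).
Proof.
move=> oU /smooth_onP fU /smooth_onP gU; apply/smooth_onP => n.
exact: smooth_uptoD.
Qed.

Lemma smooth_onM U f g : open U -> smooth_on U f -> smooth_on U g ->
  smooth_on U (fun v => f v * g v).
Proof.
move=> oU /smooth_onP fU /smooth_onP gU; apply/smooth_onP => n.
exact: smooth_uptoM.
Qed.

Lemma smooth_onV U f : open U -> (forall v, U v -> f v != 0) -> smooth_on U f ->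
  smooth_on U (fun v => (f v)^-1).
Proof.
by move=> oU fN0 /smooth_onP fU; apply/smooth_onP => n; exact: smooth_uptoV.
Qed.

End SmoothOn.

(** * Smooth functions on a manifold, read in one chart *)

Section SmoothIn.
Context {R : realType} {d : nat}.
Variables (M : manifold R d) (c : chart M).
Implicit Types (f g : M -> R) (u v : M -> R[i]).
Local Open Scope complex_scope.

Lemma smooth_in_eq f g : (forall x, chart_dom c x -> f x = g x) ->
  smooth_in c f -> smooth_in c g.
Proof.
move=> fg; apply: smooth_on_eq => [|_ [x cx <-]]; first exact: chart_img_open.
by rewrite /= chart_mapK // fg.
Qed.

Lemma smooth_in_cst (r : R) : smooth_in c (fun=> r).
Proof. exact: smooth_on_cst. Qed.

Lemma smooth_inD f g : smooth_in c f -> smooth_in c g -> smooth_in c (fun x => f x + g x).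
Proof. by move=> fc gc; apply: smooth_onD fc gc; exact: chart_img_open. Qed.

Lemma smooth_inM f g : smooth_in c f -> smooth_in c g -> smooth_in c (fun x => f x * g x).
Proof. by move=> fc gc; apply: smooth_onM fc gc; exact: chart_img_open. Qed.

Lemma smooth_inN f : smooth_in c f -> smooth_in c (fun x => - f x).
Proof.
move=> fc; apply: (smooth_in_eq _ (smooth_inM (smooth_in_cst (-1)) fc)) => x _.
exact: mulN1r.
Qed.

Lemma smooth_inV f : (forall x, chart_dom c x -> f x != 0) -> smooth_in c f ->
  smooth_in c (fun x => (f x)^-1).
Proof.
move=> fN0 fc; apply: (smooth_onV _ _ fc) => [|_ [x cx <-]]; first exact: chart_img_open.
by rewrite /= chart_mapK // fN0.
Qed.

Lemma smooth_in_sum (I : Type) (r : seq I) (Q : pred I) (F : I -> M -> R) :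
  (forall i, Q i -> smooth_in c (F i)) ->
  smooth_in c (fun x => \sum_(i <- r | Q i) F i x).
Proof.
move=> Fc; elim: r => [|i r IHr].
  by apply: (smooth_in_eq _ (smooth_in_cst 0)) => x _; rewrite big_nil.
have [Qi|/negbTE Qi] := boolP (Q i); last first.
  by apply: (smooth_in_eq _ IHr) => x _; rewrite big_cons Qi.
by apply: (smooth_in_eq _ (smooth_inD (Fc i Qi) IHr)) => x _; rewrite big_cons Qi.
Qed.

Lemma smooth_in_prod (I : Type) (r : seq I) (F : I -> M -> R) :
  (forall i, smooth_in c (F i)) -> smooth_in c (fun x => \prod_(i <- r) F i x).
Proof.
move=> Fc; elim: r => [|i r IHr].
  by apply: (smooth_in_eq _ (smooth_in_cst 1)) => x _; rewrite big_nil.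
by apply: (smooth_in_eq _ (smooth_inM (Fc i) IHr)) => x _; rewrite big_cons.
Qed.

Lemma smooth_in_det m (A : M -> 'M[R]_m) :
  (forall i j, smooth_in c (fun x => A x i j)) -> smooth_in c (fun x => \det (A x)).
Proof.
move=> Ac; apply: smooth_in_sum => s _; apply: smooth_inM; first exact: smooth_in_cst.
by apply: smooth_in_prod => i.
Qed.

(** Cramer's formula: cofactors divided by the determinant. It serves for the Poisson tensor, the
    inverse matrix of [omega]. *)
Lemma smooth_in_invmx m (A : M -> 'M[R]_m) :
  (forall i j, smooth_in c (fun x => A x i j)) ->
  (forall x, chart_dom c x -> A x \in unitmx) ->
  forall i j, smooth_in c (fun x => invmx (A x) i j).
Proof.
move=> Ac Au i j.
have detc : smooth_in c (fun x => (\det (A x))^-1).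
  apply: smooth_inV; last exact: smooth_in_det.
  by move=> x /Au; rewrite unitmxE unitfE.
have cofc : smooth_in c (fun x => cofactor (A x) j i).
  apply: smooth_inM; first exact: smooth_in_cst.
  apply: smooth_in_det => k l.
  by apply: smooth_in_eq (Ac (lift j k) (lift i l)) => x _; rewrite !mxE.
apply: smooth_in_eq (smooth_inM detc cofc) => x cx.
by rewrite /invmx Au // !mxE.
Qed.

Lemma smoothC_in_eq u v : (forall x, chart_dom c x -> u x = v x) ->
  smoothC_in c u -> smoothC_in c v.
Proof.
move=> uv [ur ui]; split.
  by apply: smooth_in_eq ur => x cx; rewrite uv.
by apply: smooth_in_eq ui => x cx; rewrite uv.
Qed.

Lemma smoothC_in_cst (z : R[i]) : smoothC_in c (fun=> z).
Proof. by split; exact: smooth_in_cst. Qed.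

Lemma smoothC_in_real f : smooth_in c f -> smoothC_in c (fun x => (f x)%:C).
Proof. by move=> fc; split; [exact: fc | exact: smooth_in_cst]. Qed.

Lemma smoothC_inD u v : smoothC_in c u -> smoothC_in c v -> smoothC_in c (fun x => u x + v x).
Proof.
move=> [ur ui] [vr vi]; split.
  by apply: smooth_in_eq (smooth_inD ur vr) => x _; rewrite raddfD.
by apply: smooth_in_eq (smooth_inD ui vi) => x _; rewrite raddfD.
Qed.

Lemma smoothC_inM u v : smoothC_in c u -> smoothC_in c v -> smoothC_in c (fun x => u x * v x).
Proof.
move=> [ur ui] [vr vi]; split.
  apply: smooth_in_eq (smooth_inD (smooth_inM ur vr) (smooth_inN (smooth_inM ui vi))).
  by move=> x _; case: (u x) (v x) => [? ?] [? ?].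
apply: smooth_in_eq (smooth_inD (smooth_inM ur vi) (smooth_inM ui vr)).
by move=> x _; case: (u x) (v x) => [? ?] [? ?].
Qed.

Lemma smoothC_in_sum (I : Type) (r : seq I) (Q : pred I) (F : I -> M -> R[i]) :
  (forall i, Q i -> smoothC_in c (F i)) ->
  smoothC_in c (fun x => \sum_(i <- r | Q i) F i x).
Proof.
move=> Fc; elim: r => [|i r IHr].
  by apply: (smoothC_in_eq _ (smoothC_in_cst 0)) => x _; rewrite big_nil.
have [Qi|/negbTE Qi] := boolP (Q i); last first.
  by apply: (smoothC_in_eq _ IHr) => x _; rewrite big_cons Qi.
by apply: (smoothC_in_eq _ (smoothC_inD (Fc i Qi) IHr)) => x _; rewrite big_cons Qi.
Qed.

End SmoothIn.

(** * Formal power series in y *)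

Section MultiIndices.
Context {d : nat}.
Implicit Types (I J : mindex d) (i : 'I_d).

Definition mincr i J : mindex d := [ffun j => (J j + (j == i))%N].
Definition msub J I : mindex d := [ffun i => (J i - I i)%N].

(** With [mhom], this replaces sums over functions into a bounded ordinal type by sums over lists of
    unbounded multi-indices; shifts of indices then become permutations of lists. *)
Definition mbox J : seq (mindex d) :=
  [seq mnat K | K <- enum [pred K : {ffun 'I_d -> 'I_(mdeg J).+1} |
                             [forall i, (K i <= J i)%N]]].

Definition mhom m : seq (mindex d) :=
  [seq mnat K | K <- enum [pred K : {ffun 'I_d -> 'I_m.+1} | mdeg (mnat K) == m]].

Lemma leq_mdeg J i : (J i <= mdeg J)%N.
Proof. by rewrite /mdeg (bigD1 i) //= leq_addr. Qed.

Lemma mnat_inj N : injective (@mnat d N).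
Proof.
by move=> I J /ffunP IJ; apply/ffunP => i; apply/val_inj; have := IJ i; rewrite !ffunE.
Qed.

Lemma mnat_inord N J : (forall i, J i <= N)%N -> mnat [ffun i => inord (J i) : 'I_N.+1] = J.
Proof. by move=> JN; apply/ffunP => i; rewrite !ffunE inordK // ltnS. Qed.

Lemma mem_mbox J I : (I \in mbox J) = [forall i, (I i <= J i)%N].
Proof.
apply/mapP/forallP => [[K + ->] i|IJ]; first by rewrite mem_enum ffunE => /forallP/(_ i).
have IK : mnat [ffun i => inord (I i) : 'I_(mdeg J).+1] = I.
  by apply: mnat_inord => i; apply: leq_trans (IJ i) (leq_mdeg J i).
exists [ffun i => inord (I i)]; last by rewrite IK.
rewrite mem_enum; apply/forallP => i.
by have /ffunP/(_ i) := IK; rewrite !ffunE => ->.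
Qed.

Lemma mbox_uniq J : uniq (mbox J).
Proof. by rewrite map_inj_uniq ?enum_uniq //; exact: mnat_inj. Qed.

Lemma mem_mhom m I : (I \in mhom m) = (mdeg I == m).
Proof.
apply/mapP/eqP => [[K + ->]|Im]; first by rewrite mem_enum => /eqP.
have IK : mnat [ffun i => inord (I i) : 'I_m.+1] = I.
  by apply: mnat_inord => i; rewrite -Im leq_mdeg.
exists [ffun i => inord (I i)]; last by rewrite IK.
by rewrite mem_enum inE IK Im.
Qed.

Lemma mhom_uniq m : uniq (mhom m).
Proof. by rewrite map_inj_uniq ?enum_uniq //; exact: mnat_inj. Qed.

Lemma mincr_inj i : injective (mincr i).
Proof.
move=> I J /ffunP IJ; apply/ffunP => j; have := IJ j; rewrite !ffunE.
exact: addIn.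
Qed.

Lemma mdeg_incr i J : mdeg (mincr i J) = (mdeg J).+1.
Proof.
rewrite /mdeg -addn1 (eq_bigr (fun j => J j + (j == i))%N) => [|j _]; last by rewrite ffunE.
rewrite big_split /=; congr addn; rewrite (bigD1 i) //= eqxx big1 ?addn0 // => j.
by move/negbTE->.
Qed.

Lemma mdeg_sub J I : (forall i, I i <= J i)%N -> (mdeg I + mdeg (msub J I) = mdeg J)%N.
Proof.
by move=> IJ; rewrite /mdeg -big_split; apply: eq_bigr => i _; rewrite /= ffunE subnKC.
Qed.

Lemma mincrK i I : (0 < I i)%N -> mincr i [ffun j => (I j - (j == i))%N] = I.
Proof.
move=> Ii; apply/ffunP => j; rewrite !ffunE.
by case: eqP => [->|_]; rewrite ?subnK ?subn0 ?addn0.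
Qed.

(** Reindexing for the part of the Leibniz rule where [ydiff i] falls on the left factor;
    [mbox_up_le] serves for the right factor. *)
Lemma mbox_up i J :
  perm_eq [seq K : mindex d <- mbox (mincr i J) | (0 < K i)%N] [seq mincr i K | K <- mbox J].
Proof.
apply: uniq_perm => [||I].
- exact/filter_uniq/mbox_uniq.
- by rewrite map_inj_uniq ?mbox_uniq //; exact: mincr_inj.
rewrite mem_filter mem_mbox; apply/andP/mapP => [[Ii /forallP IJ]|[K + ->]].
  exists [ffun j => (I j - (j == i))%N]; last by rewrite mincrK.
  by rewrite mem_mbox; apply/forallP => j; have := IJ j; rewrite !ffunE leq_subLR addnC.
rewrite mem_mbox => /forallP KJ; rewrite ffunE eqxx addn1; split=> //.
by apply/forallP => j; rewrite !ffunE leq_add2r.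
Qed.

Lemma mbox_up_le i J :
  perm_eq [seq K : mindex d <- mbox (mincr i J) | (K i <= J i)%N] (mbox J).
Proof.
apply: uniq_perm => [||I]; [exact/filter_uniq/mbox_uniq|exact: mbox_uniq|].
rewrite mem_filter !mem_mbox; apply/andP/forallP => [[Ii /forallP IJ] j|IJ].
  have := IJ j; rewrite ffunE; case: (j =P i) => [->//|_]; by rewrite addn0.
by split=> //; apply/forallP => j; rewrite ffunE (leq_trans (IJ j)) // leq_addr.
Qed.

Lemma mbox_sub J : perm_eq [seq msub J K | K <- mbox J] (mbox J).
Proof.
have subK I : I \in mbox J -> msub J (msub J I) = I.
  rewrite mem_mbox => /forallP IJ; apply/ffunP => i.
  by rewrite !ffunE subKn.
have sub_box I : msub J I \in mbox J.
  by rewrite mem_mbox; apply/forallP => i; rewrite ffunE leq_subr.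
apply: uniq_perm => [||I]; last 1 first.
- apply/mapP/idP => [[K _ ->] //|IJ]; by exists (msub J I); rewrite ?subK.
- rewrite map_inj_in_uniq ?mbox_uniq // => I K IJ KJ IK.
  by rewrite -(subK I) // IK subK.
exact: mbox_uniq.
Qed.

Lemma mhom_up i m :
  perm_eq [seq K : mindex d <- mhom m.+1 | (0 < K i)%N] [seq mincr i K | K <- mhom m].
Proof.
apply: uniq_perm => [||I].
- exact/filter_uniq/mhom_uniq.
- by rewrite map_inj_uniq ?mhom_uniq //; exact: mincr_inj.
rewrite mem_filter mem_mhom; apply/andP/mapP => [[Ii /eqP Im]|[K + ->]].
  exists [ffun j => (I j - (j == i))%N]; last by rewrite mincrK.
  by rewrite mem_mhom -eqSS -(mdeg_incr i) mincrK // Im.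
by rewrite mem_mhom mdeg_incr eqSS ffunE eqxx addn1.
Qed.

End MultiIndices.

(** * Products, derivatives and linear substitutions of series in [y] *)

Section YSeries.
Context {R : realType} {d : nat}.
Implicit Types (p q : yseries R d) (J I : mindex d) (i : 'I_d).
Local Open Scope complex_scope.

Lemma ymulE p q J : ymul p q J = \sum_(I <- mbox J) p I * q (msub J I).
Proof.
rewrite /ymul /mbox big_map big_enum_cond; apply: eq_big => [I|I _]; first by rewrite inE andbT.
by congr (_ * q _); apply/ffunP => i; rewrite !ffunE.
Qed.

Lemma yevalE m p (y : 'rV[R]_d) :
  yeval m p y = \sum_(J <- mhom m) p J * \prod_i (y 0 i ^+ J i)%:C.
Proof.
rewrite /yeval /mhom big_map big_enum_cond; apply: eq_big => [I|I _]; first by rewrite inE andbT.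
by congr (_ * _); apply: eq_bigr => i _; rewrite ffunE.
Qed.

Lemma ymulC p q : ymul p q = ymul q p.
Proof.
apply/funext => J; rewrite !ymulE -(perm_big _ (mbox_sub J)) big_map.
apply: eq_big_seq => I; rewrite mem_mbox => /forallP IJ.
rewrite mulrC; congr (q _ * _); apply/ffunP => i.
by rewrite !ffunE subKn.
Qed.

Lemma ydiff_mul i p q J :
  ydiff i (ymul p q) J = ymul (ydiff i p) q J + ymul p (ydiff i q) J.
Proof.
rewrite /ydiff -/(mincr i J) !ymulE mulr_sumr.
(* The factor [J i + 1] splits into the exponents of the variable [i] in the two factors, [I i] and
   [J i + 1 - I i]. *)
rewrite (eq_big_seq (fun I => (I i)%:R * (p I * q (msub (mincr i J) I))
   + ((J i).+1 - I i)%:R * (p I * q (msub (mincr i J) I)))); last first.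
  move=> I; rewrite mem_mbox => /forallP/(_ i); rewrite ffunE eqxx addn1 => Ii.
  by rewrite -mulrDl -natrD subnKC.
rewrite big_split /=; congr (_ + _).
  rewrite (bigID (fun I => (0 < I i)%N)) /= [X in _ + X]big1 ?addr0; last first.
    by move=> I; rewrite -eqn0Ngt => /eqP ->; rewrite mul0r.
  rewrite -big_filter (perm_big _ (mbox_up i J)) big_map; apply: eq_bigr => I _.
  rewrite ffunE eqxx addn1 mulrA; congr (_ * q _); apply/ffunP => j.
  by rewrite !ffunE subnDr.
rewrite (bigID (fun I => (I i <= J i)%N)) /= [X in _ + X]big1_seq ?addr0; last first.
  move=> I; rewrite -ltnNge => /andP [Ii _].
  by rewrite (eqP (_ : (J i).+1 - I i == 0)%N) ?mul0r // subn_eq0.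
rewrite -big_filter (perm_big _ (mbox_up_le i J)); apply: eq_big_seq => I.
rewrite mem_mbox => /forallP IJ.
rewrite mulrCA ffunE subSn //; congr (_ * (_ * q _)); apply/ffunP => j.
by rewrite !ffunE addnBAC.
Qed.

Lemma ydiff_sum i (T : Type) (r : seq T) (B : pred T) (z : T -> R[i]) (p : T -> yseries R d) :
  ydiff i (fun J => \sum_(t <- r | B t) z t * p t J)
  = fun J => \sum_(t <- r | B t) z t * ydiff i (p t) J.
Proof.
apply/funext => J; rewrite /ydiff mulr_sumr; apply: eq_bigr => t _.
by rewrite mulrCA.
Qed.

Lemma ymul_suml (T : Type) (r : seq T) (B : pred T) (z : T -> R[i])
    (p : T -> yseries R d) q :
  ymul (fun J => \sum_(t <- r | B t) z t * p t J) q
  = fun J => \sum_(t <- r | B t) z t * ymul (p t) q J.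
Proof.
apply/funext => J; rewrite ymulE.
under eq_bigr do rewrite mulr_suml.
rewrite exchange_big /=; apply: eq_bigr => t _.
rewrite ymulE mulr_sumr; apply: eq_bigr => K _.
by rewrite mulrA.
Qed.

Lemma ydiff_const i (z : R[i]) : ydiff i (yconst z : yseries R d) = fun=> 0.
Proof. by apply/funext => J; rewrite /ydiff /yconst -/(mincr i J) mdeg_incr mulr0. Qed.

Lemma mdeg0 : mdeg ([ffun=> 0%N] : mindex d) = 0%N.
Proof. by rewrite /mdeg big1 // => i _; rewrite ffunE. Qed.

Lemma mdeg_eq0 J : (mdeg J == 0%N) = (J == [ffun=> 0%N]).
Proof.
apply/eqP/eqP => [J0|->]; last exact: mdeg0.
by apply/ffunP => i; rewrite ffunE; apply/eqP; rewrite -leqn0 -J0 leq_mdeg.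
Qed.

Lemma ymul_const (z : R[i]) p : ymul (yconst z) p = fun J => z * p J.
Proof.
apply/funext => J; rewrite ymulE (bigD1_seq [ffun=> 0%N]) ?mbox_uniq //=; last first.
  by rewrite mem_mbox; apply/forallP => i; rewrite ffunE.
rewrite /yconst mdeg0 eqxx big1 ?addr0 => [|K /negbTE K0].
  by congr (_ * p _); apply/ffunP => i; rewrite !ffunE subn0.
by rewrite mdeg_eq0 K0 mul0r.
Qed.

Lemma ymul0 p q : ymul p q [ffun=> 0%N] = p [ffun=> 0%N] * q [ffun=> 0%N].
Proof.
rewrite ymulE (perm_big [:: [ffun=> 0%N]]) ?big_seq1.
  by congr (_ * q _); apply/ffunP => i; rewrite !ffunE.
apply: uniq_perm => // [|K]; first exact: mbox_uniq.
rewrite mem_mbox mem_seq1 -mdeg_eq0; apply/forallP/eqP => [K0|K0 i].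
  by rewrite /mdeg big1 // => i _; have := K0 i; rewrite ffunE leqn0 => /eqP.
by rewrite ffunE -K0 leq_mdeg.
Qed.

Lemma yeval0 p (y : 'rV[R]_d) : yeval 0 p y = p [ffun=> 0%N].
Proof.
rewrite yevalE (perm_big [:: [ffun=> 0%N]]) ?big_seq1.
  by rewrite big1 ?mulr1 // => i _; rewrite ffunE expr0.
apply: uniq_perm => // [|K]; first exact: mhom_uniq.
by rewrite mem_mhom mem_seq1 mdeg_eq0.
Qed.

(* The polynomial function [t |-> yeval m p (y + t v)]. *)
Definition yline m p (y v : 'rV[R]_d) : {poly R[i]} :=
  \sum_(J <- mhom m)
    (p J)%:P * \prod_i ((y 0 i)%:C%:P + (v 0 i)%:C *: 'X) ^+ J i.

Lemma yline_horner m p (y v : 'rV[R]_d) (t : R) :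
  (yline m p y v).[t%:C] = yeval m p (y + t *: v).
Proof.
rewrite yevalE horner_sum; apply: eq_bigr => J _.
rewrite hornerM hornerC horner_prod; congr (_ * _); apply: eq_bigr => i _.
rewrite horner_exp hornerD hornerC hornerZ hornerX !mxE rmorphXn rmorphD rmorphM /=.
by rewrite [_ * t%:C]mulrC.
Qed.

Lemma deriv_prod (K : comNzRingType) (T : eqType) (r : seq T) (F : T -> {poly K}) :
  uniq r ->
  (\prod_(i <- r) F i)^`() = \sum_(i <- r) (F i)^`() * \prod_(j <- r | j != i) F j.
Proof.
elim: r => [|x r IHr] /=; first by rewrite !big_nil derivC.
move=> /andP [xr ur]; rewrite !big_cons derivM IHr // eqxx /=.
have neqx j : j \in r -> j != x by apply: contraTneq => ->.
congr (_ + _).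
  congr (_ * _); rewrite big_seq [RHS]big_seq_cond; apply: eq_bigl => j.
  by case: (boolP (j \in r)) => // /neqx ->.
rewrite mulr_sumr; apply: eq_big_seq => i /neqx ix.
by rewrite big_cons eq_sym ix mulrCA.
Qed.

(** Chain rule at [t = 0]: the bridge from polynomial functions, which govern the change of charts,
    to the formal derivatives [ydiff]. *)
Lemma yline_deriv m p (y v : 'rV[R]_d) :
  (yline m.+1 p y v)^`().[0] = \sum_i (v 0 i)%:C * yeval m (ydiff i p) y.
Proof.
pose rest (J : mindex d) i := \prod_(j < d | j != i) (y 0 j)%:C ^+ J j.
transitivity (\sum_(J <- mhom m.+1) \sum_i
    (v 0 i)%:C * ((J i)%:R * (p J * ((y 0 i)%:C ^+ (J i).-1 * rest J i)))).
  rewrite raddf_sum horner_sum; apply: eq_bigr => J _.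
  rewrite /= deriv_mulC hornerM hornerC deriv_prod ?index_enum_uniq //.
  rewrite horner_sum mulr_sumr; apply: eq_bigr => i _.
  rewrite hornerM horner_prod deriv_exp derivD derivC add0r derivZ derivX.
  rewrite hornerMn hornerM hornerZ hornerC horner_exp hornerD hornerZ hornerX.
  rewrite !hornerC mulr0 addr0 mulr1 -mulr_natl.
  rewrite (_ : \prod_(j < d | j != i) _ = rest J i); last first.
    by apply: eq_bigr => j _; rewrite horner_exp hornerD hornerC hornerZ hornerX mulr0 addr0.
  by ring.
rewrite exchange_big /=; apply: eq_bigr => i _.
rewrite -mulr_sumr; congr (_ * _).
rewrite (bigID (fun J : mindex d => (0 < J i)%N)) /= [X in _ + X]big1 ?addr0; last first.
  by move=> J; rewrite -eqn0Ngt => /eqP ->; rewrite mul0r.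
rewrite -big_filter (perm_big _ (mhom_up i m)) big_map yevalE; apply: eq_bigr => J _.
rewrite ffunE eqxx addn1 /= mulrA; congr (_ * _).
rewrite [RHS](bigD1 i) //= rmorphXn; congr (_ * _).
by apply: eq_bigr => j /negbTE ji; rewrite ffunE ji addn0 rmorphXn.
Qed.

(** Tangent vectors are real while coefficients are complex; the natural numbers already supply more
    real roots than a nonzero polynomial can have. *)
Lemma poly_eq_real (f g : {poly R[i]}) : (forall t : R, f.[t%:C] = g.[t%:C]) -> f = g.
Proof.
move=> fg; apply/eqP; rewrite -subr_eq0; apply/eqP.
apply: (@roots_geq_poly_eq0 _ _ [seq (k%:R : R)%:C | k <- iota 0 (size (f - g))]).
- by apply/allP => _ /mapP [k _ ->]; rewrite rootE hornerD hornerN fg subrr.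
- rewrite map_inj_uniq ?iota_uniq // => k l /complexI /eqP.
  by rewrite eqr_nat => /eqP.
- by rewrite size_map size_iota.
Qed.

(* [p (y) = p' (y A)] up to order [n] in [y], expressed through the derivatives
   at [0]. *)
Fixpoint ycov (A : 'M[R]_d) n p p' : Prop :=
  p [ffun=> 0%N] = p' [ffun=> 0%N] /\
  if n is n'.+1 then
    forall i, ycov A n' (ydiff i p) (fun J => \sum_j (A i j)%:C * ydiff j p' J)
  else True.

Lemma yeval_ycov (A : 'M[R]_d) p p' :
  (forall m y, yeval m p y = yeval m p' (y *m A)) -> forall n, ycov A n p p'.
Proof.
move=> + n; elim: n p p' => [|n IHn] p p' pp'.
  by split=> //; have := pp' 0%N 0; rewrite !yeval0.
split=> [|i]; first by have := pp' 0%N 0; rewrite !yeval0.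
apply: IHn => m y.
(* The substitution [y -> yA] maps the line through [y] along the [i]-th basis vector to the line
   through [yA] along row [i] of [A]. Differentiating in [t] gives the hypothesis for [ydiff i p],
   one degree lower. *)
have lineE : yline m.+1 p y (delta_mx 0 i) = yline m.+1 p' (y *m A) (row i A).
  apply: poly_eq_real => t.
  by rewrite !yline_horner pp' mulmxDl -scalemxAl -rowE.
have := congr1 (fun f => f^`().[0]) lineE; rewrite !yline_deriv.
rewrite (bigD1 i) //= mxE !eqxx mul1r big1 ?addr0 => [->|j /negbTE ji]; last first.
  by rewrite mxE eqxx ji mul0r.
rewrite yevalE; under [RHS]eq_bigr do rewrite mulr_suml.
rewrite exchange_big; apply: eq_bigr => j _ /=.
rewrite mxE yevalE mulr_sumr; apply: eq_bigr => J _.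
by rewrite mulrA.
Qed.

Lemma ycov_le A m n p p' : (m <= n)%N -> ycov A n p p' -> ycov A m p p'.
Proof.
elim: m n p p' => [|m IHm] [|n] p p' // mn [p0 pS]; split=> // i.
exact: IHm mn (pS i).
Qed.

Lemma ycov_sum A n (T : Type) (r : seq T) (B : pred T) (z : T -> R[i])
    (p p' : T -> yseries R d) : (forall t, ycov A n (p t) (p' t)) ->
  ycov A n (fun J => \sum_(t <- r | B t) z t * p t J)
           (fun J => \sum_(t <- r | B t) z t * p' t J).
Proof.
elim: n p p' => [|n IHn] p p' pp'.
  by split=> //; apply: eq_bigr => t _; rewrite (pp' t).1.
split=> [|i]; first by apply: eq_bigr => t _; rewrite (pp' t).1.
rewrite ydiff_sum [X in ycov _ _ _ X](_ : _ = fun J => \sum_(t <- r | B t) z t *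
    (\sum_j (A i j)%:C * ydiff j (p' t) J)).
  by apply: IHn => t; exact: (pp' t).2.
apply/funext => J; under eq_bigr do rewrite ydiff_sum mulr_sumr.
rewrite exchange_big /=; apply: eq_bigr => t _.
by rewrite mulr_sumr; apply: eq_bigr => j _; rewrite mulrCA.
Qed.

Lemma ycovD A n p p' q q' : ycov A n p p' -> ycov A n q q' ->
  ycov A n (fun J => p J + q J) (fun J => p' J + q' J).
Proof.
move=> pp' qq'.
have add2 (f g : yseries R d) : (fun J => f J + g J)
    = fun J => \sum_(b <- [:: true; false]) 1 * (if b then f else g) J.
  by apply/funext => J; rewrite !big_cons big_nil addr0 !mul1r.
rewrite (add2 p) (add2 p').
have := @ycov_sum A n bool [:: true; false] xpredT (fun=> 1)
  (fun b => if b then p else q) (fun b => if b then p' else q').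
by apply=> -[].
Qed.

Lemma ycov0 A n : ycov A n (fun=> 0) (fun=> 0).
Proof.
have diff0 i : ydiff i (fun=> 0 : R[i]) = fun=> 0.
  by apply/funext => J; rewrite /ydiff mulr0.
elim: n => [|n IHn]; split=> // i.
rewrite [X in ycov _ _ _ X](_ : _ = fun=> 0) ?diff0 //.
by apply/funext => J; rewrite big1 // => j _; rewrite diff0 mulr0.
Qed.

Lemma ycov_const A n (z : R[i]) : ycov A n (yconst z) (yconst z).
Proof.
case: n => [|n]; split=> // i; rewrite ydiff_const.
rewrite [X in ycov _ _ _ X](_ : _ = fun=> 0); first exact: ycov0.
by apply/funext => J; rewrite big1 // => j _; rewrite ydiff_const mulr0.
Qed.

(** Both products obey the Leibniz rule, so order [n + 1] reduces to order [n] without expanding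
    powers of [yA]. *)
Lemma ycov_mul A n p p' q q' : ycov A n p p' -> ycov A n q q' ->
  ycov A n (ymul p q) (ymul p' q').
Proof.
elim: n p p' q q' => [|n IHn] p p' q q' pp' qq'.
  by split=> //; rewrite !ymul0 pp'.1 qq'.1.
split=> [|i]; first by rewrite !ymul0 pp'.1 qq'.1.
have -> : ydiff i (ymul p q) = fun J => ymul (ydiff i p) q J + ymul p (ydiff i q) J.
  by apply/funext => J; rewrite ydiff_mul.
rewrite [X in ycov _ _ _ X](_ : _ = fun J =>
    ymul (fun K => \sum_j (A i j)%:C * ydiff j p' K) q' J
    + ymul p' (fun K => \sum_j (A i j)%:C * ydiff j q' K) J).
  apply: ycovD; apply: IHn.
  - exact: pp'.2.
  - exact: ycov_le (leqnSn n) qq'.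
  - exact: ycov_le (leqnSn n) pp'.
  - exact: qq'.2.
apply/funext => J.
rewrite (ymulC p' (fun K => \sum_j (A i j)%:C * ydiff j q' K)) !ymul_suml -big_split /=.
by apply: eq_bigr => j _; rewrite ydiff_mul mulrDr [ymul _ p']ymulC.
Qed.

End YSeries.

(** * The Weyl algebra *)

Lemma sum_triangle (V : nmodType) k (F : nat -> nat -> V) :
  \sum_(n < k.+1) \sum_(l < (k - n).+1) F n l
  = \sum_(l < k.+1) \sum_(n < (k - l).+1) F n l.
Proof.
have widen (G : nat -> nat -> V) : \sum_(n < k.+1) \sum_(l < (k - n).+1) G n l
    = \sum_(n < k.+1) \sum_(l < k.+1 | (n + l <= k)%N) G n l.
  apply: eq_bigr => n _.
  rewrite (big_ord_widen k.+1 (G n)) ?ltnS ?leq_subr //.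
  by apply: eq_bigl => l; have := ltn_ord n; lia.
rewrite (widen F) (widen (fun l n => F n l)) (exchange_big_dep xpredT) //=.
by apply: eq_bigr => l _; apply: eq_bigl => n; rewrite addnC.
Qed.

Lemma sum_tuple_cons (V : nmodType) (T : finType) n (F : n.+1.-tuple T -> V) :
  \sum_s F s = \sum_i \sum_(s : n.-tuple T) F [tuple of i :: s].
Proof.
rewrite pair_big /= (reindex (fun u : T * n.-tuple T => [tuple of u.1 :: u.2])) //=.
exists (fun s => (thead s, [tuple of behead s])) => [[i s] _|s _] /=.
  by congr pair; apply/val_inj.
by rewrite [RHS]tuple_eta.
Qed.

(** Cauchy product with a finitely supported sequence, for partial sums: [f j] multiplies a partial
    sum of [e] shortened by [j] (empty if [N <= j]). The limit in [N] then involves only [D]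
    sequences. *)
Lemma sum_convolution (K : comNzRingType) (e f : nat -> K) D N :
  (forall j, (D <= j)%N -> f j = 0) ->
  \sum_(m < N) \sum_(j < m.+1) e (m - j)%N * f j
  = \sum_(j < D) f j * \sum_(i < N - j) e i.
Proof.
move=> fD; elim: N => [|N IHN].
  by rewrite big_ord0 big1 // => j _; rewrite sub0n big_ord0 mulr0.
rewrite big_ord_recr IHN /=.
transitivity (\sum_(j < D) f j * \sum_(i < N - j) e i
              + \sum_(j < D | (j < N.+1)%N) e (N - j)%N * f j).
  congr (_ + _); case: (leqP D N.+1) => DN.
    rewrite -(big_mkord xpredT (fun j => e (N - j)%N * f j)).
    rewrite (big_cat_nat (leq0n D) DN) /= [X in _ + X]big_nat_cond [X in _ + X]big1 => [|j].
      rewrite addr0 big_mkord; apply: eq_bigl => j.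
      by rewrite (leq_trans (ltn_ord j) DN).
    by rewrite andbT => /andP [/fD ->]; rewrite mulr0.
  by rewrite (big_ord_widen _ (fun j => e (N - j)%N * f j) (ltnW DN)).
rewrite [X in _ + X]big_mkcond -big_split /=; apply: eq_bigr => j _.
case: ltnP => jN; last first.
  rewrite addr0; congr (_ * _).
  have -> : (N.+1 - j = 0)%N by apply/eqP; rewrite subn_eq0.
  by have -> : (N - j = 0)%N by apply/eqP; rewrite subn_eq0 ltnW.
by rewrite subSn // big_ord_recr /= mulrDr [e _ * _]mulrC.
Qed.

Section Weyl.
Context {R : realType} {d : nat}.
Implicit Types (p q : yseries R d) (a b : weyl R d) (J I : mindex d) (i : 'I_d)
  (P : 'M[R]_d).
Local Open Scope complex_scope.

Lemma ydiffC i j p : ydiff i (ydiff j p) = ydiff j (ydiff i p).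
Proof.
apply/funext => J; rewrite /ydiff !mulrA !ffunE; congr (_ * p _).
  by rewrite eq_sym; case: eqP => [->|_]; rewrite ?addn0 // mulrC.
by apply/ffunP => k; rewrite !ffunE addnAC.
Qed.

Lemma foldr_ydiff i p s : foldr ydiff (ydiff i p) s = ydiff i (foldr ydiff p s).
Proof. by elim: s => //= j s ->; rewrite ydiffC. Qed.

(* The bidifferential operator [P^{i1 j1} .. P^{in jn} d_{i1} .. d_{in} p
   d_{j1} .. d_{jn} q] of the Weyl product. *)
Fixpoint moyal P n p q : yseries R d :=
  if n is n'.+1 then
    fun J => \sum_i \sum_j (P i j)%:C * moyal P n' (ydiff i p) (ydiff j q) J
  else ymul p q.

(** Replaces the sums over tuples in [wmul] by a recursion, so that properties of contractions are
    proved by induction on [n]. *)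
Lemma moyalE P n p q J : moyal P n p q J =
  \sum_(s : n.-tuple 'I_d) \sum_(t : n.-tuple 'I_d)
     (\prod_(r < n) P (tnth s r) (tnth t r))%:C
     * ymul (foldr ydiff p s) (foldr ydiff q t) J.
Proof.
elim: n p q => [|n IHn] p q /=.
  have tup0 (F : 0.-tuple 'I_d -> R[i]) : \sum_s F s = F [tuple].
    by rewrite (big_pred1 [tuple]) // => s; apply/esym/eqP; exact: tuple0.
  by rewrite !tup0 big_ord0 mul1r.
rewrite sum_tuple_cons; apply: eq_bigr => i _.
under [RHS]eq_bigr do rewrite sum_tuple_cons.
rewrite [RHS]exchange_big; apply: eq_bigr => j _ /=.
rewrite IHn mulr_sumr; apply: eq_bigr => s _.
rewrite mulr_sumr; apply: eq_bigr => t _.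
rewrite big_ord_recl !tnth0 rmorphM /= mulrA !foldr_ydiff; congr (_ * _%:C * _).
by apply: eq_bigr => r _; rewrite !tnthS.
Qed.

(** Exchanging the factors transposes [P]; results on the left factor thus yield those on the right
    one. *)
Lemma moyal_tr P n p q : moyal P n p q = moyal P^T n q p.
Proof.
elim: n p q => [|n IHn] p q /=; first exact: ymulC.
apply/funext => J; rewrite exchange_big; apply: eq_bigr => j _ /=.
by apply: eq_bigr => i _; rewrite mxE IHn.
Qed.

Lemma moyal_suml P n (T : Type) (r : seq T) (B : pred T) (z : T -> R[i])
    (p : T -> yseries R d) q :
  moyal P n (fun J => \sum_(t <- r | B t) z t * p t J) q
  = fun J => \sum_(t <- r | B t) z t * moyal P n (p t) q J.
Proof.
elim: n p q => [|n IHn] p q /=; first exact: ymul_suml.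
apply/funext => J; under [RHS]eq_bigr do rewrite mulr_sumr.
rewrite [RHS]exchange_big; apply: eq_bigr => i _ /=.
under [RHS]eq_bigr do rewrite mulr_sumr.
rewrite [RHS]exchange_big; apply: eq_bigr => j _ /=.
rewrite ydiff_sum IHn mulr_sumr; apply: eq_bigr => t _.
by rewrite mulrCA.
Qed.

Lemma moyal_sumr P n (T : Type) (r : seq T) (B : pred T) (z : T -> R[i])
    p (q : T -> yseries R d) :
  moyal P n p (fun J => \sum_(t <- r | B t) z t * q t J)
  = fun J => \sum_(t <- r | B t) z t * moyal P n p (q t) J.
Proof.
rewrite moyal_tr moyal_suml; apply/funext => J.
by apply: eq_bigr => t _; rewrite [in RHS]moyal_tr.
Qed.

Lemma moyal0 P n p : moyal P n (fun=> 0) p = fun=> 0.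
Proof.
have := @moyal_suml P n 'I_d [::] xpredT (fun=> 0) (fun=> fun=> 0) p.
under eq_fun do rewrite big_nil.
by move=> ->; apply/funext => J; rewrite big_nil.
Qed.

Lemma moyal_const P n (z : R[i]) q : (0 < n)%N -> moyal P n (yconst z) q = fun=> 0.
Proof.
case: n => // n _; apply/funext => J /=.
rewrite big1 // => i _; rewrite big1 // => j _.
by rewrite ydiff_const moyal0 mulr0.
Qed.

(** Each contraction differentiates both factors once and costs two degrees in [y], exactly what the
    accompanying factor lambda restores. *)
Lemma moyal_order P n p q (m m' : nat) :
  (forall J, (mdeg J < m)%N -> p J = 0) -> (forall J, (mdeg J < m')%N -> q J = 0) ->
  forall J, (mdeg J + 2 * n < m + m')%N -> moyal P n p q J = 0.
Proof.
elim: n p q m m' => [|n IHn] p q m m' pm qm J /= Jm.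
  rewrite ymulE big1_seq // => K /andP [_]; rewrite mem_mbox => /forallP KJ.
  have := mdeg_sub KJ; case: (ltnP (mdeg K) m) => [/pm ->|mK]; first by rewrite mul0r.
  by move=> KE; rewrite qm ?mulr0 //; lia.
rewrite big1 // => i _; rewrite big1 // => j _; rewrite (IHn _ _ m.-1 m'.-1) ?mulr0 //.
- by move=> K Km; rewrite /ydiff -/(mincr i K) pm ?mulr0 // mdeg_incr; lia.
- by move=> K Km; rewrite /ydiff -/(mincr j K) qm ?mulr0 // mdeg_incr; lia.
- by lia.
Qed.

(** Each derivative of [p] or [q] brings out one factor [A]; the two factors of a contraction are
    absorbed into its matrix, which becomes [A^T P A]. *)
Lemma ycov_moyal (A : 'M[R]_d) P n p p' q q' :
  (forall m, ycov A m p p') -> (forall m, ycov A m q q') ->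
  forall m, ycov A m (moyal P n p q) (moyal (A^T *m P *m A) n p' q').
Proof.
elim: n p p' q q' => [|n IHn] p p' q q' pp' qq' m /=; first exact: ycov_mul.
pose lin (r : yseries R d) i J := \sum_j (A i j)%:C * ydiff j r J.
have QE j l : ((A^T *m P *m A) j l)%:C
    = \sum_(u : 'I_d * 'I_d) (P u.1 u.2)%:C * (A u.1 j)%:C * (A u.2 l)%:C.
  transitivity (\sum_k \sum_i (P i k)%:C * (A i j)%:C * (A k l)%:C).
    rewrite mxE rmorph_sum; apply: eq_bigr => k _.
    rewrite mxE mulr_suml rmorph_sum; apply: eq_bigr => i _.
    by rewrite !mxE !rmorphM /= [_ * (P i k)%:C]mulrC.
  by rewrite exchange_big pair_big.
have -> : (fun J => \sum_i \sum_j ((A^T *m P *m A) i j)%:C *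
      moyal (A^T *m P *m A) n (ydiff i p') (ydiff j q') J)
    = fun J => \sum_(u : 'I_d * 'I_d) (P u.1 u.2)%:C *
        moyal (A^T *m P *m A) n (lin p' u.1) (lin q' u.2) J.
  apply/funext => J; set Q := A^T *m P *m A; rewrite pair_big /=.
  under [RHS]eq_bigr => u _.
    rewrite /lin moyal_suml mulr_sumr.
    under eq_bigr do rewrite moyal_sumr !mulr_sumr.
    rewrite pair_big /=.
    over.
  rewrite exchange_big /=; apply: eq_bigr => -[j l] _ /=.
  rewrite QE mulr_suml; apply: eq_bigr => u _.
  by rewrite !mulrA.
rewrite (_ : (fun J => \sum_i _) = fun J => \sum_(u : 'I_d * 'I_d) (P u.1 u.2)%:C *
    moyal P n (ydiff u.1 p) (ydiff u.2 q) J); last first.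
  by apply/funext => J; rewrite pair_big.
apply: ycov_sum => u; apply: IHn => m'; [exact: (pp' m'.+1).2 | exact: (qq' m'.+1).2].
Qed.

Lemma wmulE P a b k J : wmul P a b k J =
  \sum_(n < k.+1) \sum_(l < (k - n).+1)
     (2%:R ^+ n * n`!%:R)^-1 * moyal P n (a l) (b (k - n - l)%N) J.
Proof. by apply: eq_bigr => n _; apply: eq_bigr => l _; rewrite moyalE. Qed.

Lemma wmul_tr P a b : wmul P a b = wmul P^T b a.
Proof.
apply/funext => k; apply/funext => J; rewrite !wmulE; apply: eq_bigr => n _.
rewrite [RHS](reindex_inj rev_ord_inj); apply: eq_bigr => l _ /=.
rewrite subSS subKn; last by rewrite -ltnS.
by rewrite moyal_tr.
Qed.

Lemma eq_wmul P a a' b b' k J :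
  (forall l, (l <= k)%N -> a l = a' l) -> (forall l, (l <= k)%N -> b l = b' l) ->
  wmul P a b k J = wmul P a' b' k J.
Proof.
move=> aa' bb'; rewrite !wmulE; apply: eq_bigr => n _; apply: eq_bigr => l _.
rewrite aa' ?bb' //; first by rewrite -subnDA leq_subr.
by rewrite (leq_trans (leq_ord l)) // leq_subr.
Qed.

Lemma wmul_suml P (T : Type) (r : seq T) (B : pred T) (z : T -> R[i])
    (a : T -> weyl R d) b :
  wmul P (fun k J => \sum_(t <- r | B t) z t * a t k J) b
  = fun k J => \sum_(t <- r | B t) z t * wmul P (a t) b k J.
Proof.
apply/funext => k; apply/funext => J; rewrite wmulE.
under [RHS]eq_bigr do rewrite wmulE mulr_sumr.
rewrite [RHS]exchange_big; apply: eq_bigr => n _ /=.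
under [RHS]eq_bigr do rewrite mulr_sumr.
rewrite [RHS]exchange_big; apply: eq_bigr => l _ /=.
by rewrite moyal_suml mulr_sumr; apply: eq_bigr => t _; rewrite mulrCA.
Qed.

Lemma wmul_sumr P (T : Type) (r : seq T) (B : pred T) (z : T -> R[i])
    a (b : T -> weyl R d) :
  wmul P a (fun k J => \sum_(t <- r | B t) z t * b t k J)
  = fun k J => \sum_(t <- r | B t) z t * wmul P a (b t) k J.
Proof.
rewrite wmul_tr wmul_suml; apply/funext => k; apply/funext => J.
by apply: eq_bigr => t _; rewrite [in RHS]wmul_tr.
Qed.

Definition wscale (z : fps R[i]) a : weyl R d :=
  fun k J => \sum_(i < k.+1) z i * a (k - i)%N J.

Lemma wmul_scaler P (z : fps R[i]) a b : wmul P a (wscale z b) = wscale z (wmul P a b).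
Proof.
apply/funext => k; apply/funext => J; rewrite wmulE.
pose F (n l i : nat) := z i * ((2%:R ^+ n * n`!%:R)^-1 * moyal P n (a l) (b (k - n - l - i)%N) J).
transitivity (\sum_(n < k.+1) \sum_(l < (k - n).+1) \sum_(i < (k - n - l).+1) F n l i).
  apply: eq_bigr => n _; apply: eq_bigr => l _.
  by rewrite moyal_sumr mulr_sumr; apply: eq_bigr => i _; rewrite mulrCA.
(* The indices range over [n + l + i <= k]; two exchanges bring [i], the order taken from [z], to
   the front. *)
under eq_bigr do rewrite sum_triangle.
rewrite (sum_triangle _ (fun n m => \sum_(l < (k - n - m).+1) F n l m)).
apply: eq_bigr => i _; rewrite wmulE mulr_sumr; apply: eq_bigr => n _.
rewrite mulr_sumr subnAC; apply: eq_bigr => l _.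
by rewrite /F (_ : (k - n - l - i = k - i - n - l)%N) //; lia.
Qed.

Lemma wmul_scalel P (z : fps R[i]) a b : wmul P (wscale z a) b = wscale z (wmul P a b).
Proof. by rewrite wmul_tr wmul_scaler [in RHS]wmul_tr. Qed.

Lemma wcomm0 P a b J : wcomm P a b 0%N J = 0.
Proof.
by rewrite /wcomm /wsub !wmulE !big_ord_recl !big_ord0 /= ymulC subrr.
Qed.

Definition wfilt m a := forall k J, (2 * k + mdeg J < m)%N -> a k J = 0.

Lemma wfilt_mul P m m' a b : wfilt m a -> wfilt m' b -> wfilt (m + m') (wmul P a b).
Proof.
move=> am bm k J kJ; rewrite wmulE big1 // => n _; rewrite big1 // => l _.
(* The coefficient of lambda^l in [a] vanishes below y-degree [m - 2 l]; when the truncated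
   difference is 0 this says nothing, as it should. *)
rewrite (moyal_order _ (m := m - 2 * l) (m' := m' - 2 * (k - n - l))) ?mulr0 //.
- by move=> K Km; apply: am; lia.
- by move=> K Km; apply: bm; lia.
- by have := ltn_ord n; have := ltn_ord l; lia.
Qed.

Lemma wfilt_pow P a m : wfilt 1 a -> wfilt m (wpow P a m).
Proof.
move=> a1; elim: m => [|m IHm]; first by [].
exact: (@wfilt_mul P 1 m).
Qed.

Lemma wmul1 P a : wmul P wone a = a.
Proof.
apply/funext => k; apply/funext => J; rewrite wmulE.
rewrite big_ord_recl [X in _ + X]big1 ?addr0 => [|n _].
  rewrite big_ord_recl big1 ?addr0 => [|l _].
    by rewrite /= ymul_const !subn0 expr0 !mul1r invr1 mul1r.
  by rewrite lift0 /wone moyal0 mulr0.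
rewrite big1 // => l _; case: (nat_of_ord l) => [|l']; rewrite /wone.
  by rewrite moyal_const ?lift0 ?mulr0.
by rewrite moyal0 mulr0.
Qed.

(* Since [z] is central, [(z + a)^m] expands by the binomial formula. *)
Lemma wpow_addC P (z : R[i]) a m k J :
  wpow P (fun k J => z * wone k J + a k J) m k J
  = \sum_(j < m.+1) 'C(m, j)%:R * z ^+ (m - j) * wpow P a j k J.
Proof.
elim: m k J => [|m IHm] k J; first by rewrite big_ord1 bin0 expr0 !mul1r.
pose w j := wpow P a j k J.
have -> : wpow P (fun k J => z * wone k J + a k J) m.+1 k J
    = \sum_(j < m.+1) 'C(m, j)%:R * z ^+ (m - j) * (z * w j + w j.+1).
  rewrite /wpow iterS -/(wpow _ _ m).
  have -> : wpow P (fun k J => z * wone k J + a k J) m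
      = fun k J => \sum_(j < m.+1) 'C(m, j)%:R * z ^+ (m - j) * wpow P a j k J.
    by apply/funext => k'; apply/funext => J'; rewrite IHm.
  rewrite wmul_sumr; apply: eq_bigr => j _; congr (_ * _).
  have -> : (fun k J => z * wone k J + a k J)
      = fun k J => \sum_(b <- [:: true; false])
          (if b then z else 1) * (if b then wone else a) k J.
    by apply/funext => k'; apply/funext => J'; rewrite !big_cons big_nil addr0 mul1r.
  by rewrite wmul_suml !big_cons big_nil addr0 wmul1 mul1r.
under eq_bigr do rewrite mulrDr.
rewrite big_split /= [RHS]big_ord_recl.
(* Pascal's rule separates the contributions of [z * w j] and of [w j.+1]. *)
under [X in _ = _ + X]eq_bigr => j _ do rewrite lift0 binS natrD !mulrDl.
rewrite big_split /= addrA; congr (_ + _).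
  rewrite big_ord_recl [X in _ = _ + X]big_ord_recr /= (bin_small (ltnSn m)) !mul0r addr0.
  rewrite !bin0 !subn0 !mul1r exprSr mulrA; congr (_ + _).
  apply: eq_bigr => j _; rewrite /bump /= add1n subSS mulrA -(mulrA _ _ z) -exprSr.
  by rewrite subnSK // ltn_ord.
Qed.

End Weyl.

(** * The exponential series *)

Section Exponential.
Context {R : realType}.
Local Open Scope complex_scope.

Lemma cvg_real_complex (u : R^nat) (l : R) :
  u @ \oo --> l -> (fun n => (u n)%:C : R[i]^o) @ \oo --> (l%:C : R[i]^o).
Proof.
(* In the order of [R[i]], a positive [e] has zero imaginary part, so it can be treated as a real
   radius. *)
move=> /cvgrPdist_lt ul; apply/cvgrPdist_lt => e; rewrite ltcE /= => /andP [/eqP Ime Ree].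
apply: filterS (ul _ Ree) => n ult.
rewrite -rmorphB normc_def /= expr0n addr0 sqrtr_sqr.
by rewrite ltcE /= Ime eqxx.
Qed.

Lemma complex_cvgn (u : nat -> R[i]) :
  cvgn (fun n => complex.Re (u n)) -> cvgn (fun n => complex.Im (u n)) ->
  cvgn (u : nat -> R[i]^o).
Proof.
move=> /cvg_real_complex ure /cvg_real_complex uim.
rewrite (_ : u = fun n => (complex.Re (u n))%:C + 'i * (complex.Im (u n))%:C).
  exact: (cvgP _ (cvgD ure (cvgZl_tmp (k := 'i : R[i]) uim))).
by apply/funext => n; exact: complexE.
Qed.

Lemma normc_ge_Im (w : R[i]) : `|complex.Im w|%:C <= `|w|.
Proof.
by case: w => a b; rewrite normc_def /= lecR -sqrtr_sqr ler_wsqrtr // lerDr sqr_ge0.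
Qed.

Lemma series_exp_le (u : R^nat) (r : R) :
  (forall m, `|u m| <= r ^+ m / m`!%:R) -> cvgn (series u).
Proof.
move=> ur; apply: normed_cvg.
apply: (series_le_cvg _ _ _ (is_cvg_series_exp_coeff r)) => m //=.
exact: le_trans (ur m).
Qed.

(** [cexp] is a [limn], so convergence has to be established: real and imaginary parts are dominated
    termwise by the real exponential series of the modulus of [z]. *)
Lemma cexp_cvg (z : R[i]) :
  (fun N => \sum_(m < N) (z ^+ m / m`!%:R : R[i]^o)) @ \oo --> (cexp z : R[i]^o).
Proof.
pose r := complex.Re `|z|.
have zr : `|z| = r%:C by rewrite /r normc_def.
have normE m : `|z ^+ m / m`!%:R| = (r ^+ m / m`!%:R)%:C.
  by rewrite normrM normrX normfV normr_nat zr rmorphM rmorphXn fmorphV rmorph_nat.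
have abs_le m : `|complex.Re (z ^+ m / m`!%:R)| <= r ^+ m / m`!%:R /\
    `|complex.Im (z ^+ m / m`!%:R)| <= r ^+ m / m`!%:R.
  by split; rewrite -lecR -normE; [exact: normc_ge_Re | exact: normc_ge_Im].
rewrite /cexp; apply: complex_cvgn.
  rewrite (_ : (fun n => _) = series (fun m => complex.Re (z ^+ m / m`!%:R))).
    exact: (series_exp_le (fun m => (abs_le m).1)).
  by apply/funext => n; rewrite raddf_sum /series /= big_mkord.
rewrite (_ : (fun n => _) = series (fun m => complex.Im (z ^+ m / m`!%:R))).
  exact: (series_exp_le (fun m => (abs_le m).2)).
by apply/funext => n; rewrite raddf_sum /series /= big_mkord.
Qed.

Lemma wexp_cvg {d} (P : 'M[R]_d) (z : R[i]) (a : weyl R d) k J : wfilt 1 a ->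
  (fun N => \sum_(m < N)
     (m`!%:R)^-1 * wpow P (fun k J => z * wone k J + a k J) m k J : R[i]^o) @ \oo -->
  (cexp z * \sum_(j < (2 * k + mdeg J).+1) (j`!%:R)^-1 * wpow P a j k J : R[i]^o).
Proof.
move=> a1; set D := (2 * k + mdeg J).+1.
pose e m : R[i] := z ^+ m / m`!%:R; pose f j : R[i] := (j`!%:R)^-1 * wpow P a j k J.
(* The [j]-th power has degree at least [j], while lambda^k y^J has degree
   [2 k + mdeg J = D - 1]. *)
have fD j : (D <= j)%N -> f j = 0 by move=> Dj; rewrite /f (wfilt_pow P a1) ?mulr0.
rewrite (_ : (fun N => _) = fun N => \sum_(j < D) f j * \sum_(i < N - j) e i).
  rewrite mulr_sumr; apply: (@cvg_big R[i]^o); first exact: add_continuous.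
  move=> j _; rewrite mulrC; apply: (@cvgZl_tmp _ R[i]^o).
  (* Delaying a sequence by [j] steps does not change its limit. *)
  rewrite (@cvg_centern j R[i]^o (fun N => \sum_(i < N) e i)).
  exact: cexp_cvg.
apply/funext => N; rewrite -sum_convolution //; apply: eq_bigr => m _.
rewrite wpow_addC mulr_sumr; apply: eq_bigr => j _.
rewrite /e /f !mulrA; congr (_ * _).
have fact_neq0 n : n`!%:R != 0 :> R[i] by rewrite pnatr_eq0 -lt0n fact_gt0.
(* C(m, j) / m! = 1 / (j! (m - j)!), the coefficient in the Cauchy product of two exponentials. *)
have := bin_fact (leq_ord j); move/(congr1 (fun n => n%:R : R[i])).
rewrite !natrM => <-; field.
by rewrite !fact_neq0 pnatr_eq0 -lt0n bin_gt0 -ltnS ltn_ord.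
Qed.

End Exponential.

(** * Sections of the Weyl bundle *)

Section DirectionalDerivative.
Context {R : realType} {d : nat}.
Variables (h v : 'rV[R]_d).
Implicit Types (f g : 'rV[R]_d -> R[i]) (z : R[i]).

Definition derivableC f : Prop :=
  derivable (fun w => complex.Re (f w)) v h /\ derivable (fun w => complex.Im (f w)) v h.

(** [dirC] differentiates real and imaginary parts separately, and a complex scalar mixes them;
    hence linearity over the complex numbers is a statement about both parts together. *)
Lemma derivableC_axpy z f g : derivableC f -> derivableC g ->
  derivableC (fun w => z * f w + g w)
  /\ dirC (fun w => z * f w + g w) h v = z * dirC f h v + dirC g h v.
Proof.
case: z => a b [fr fi] [gr gi]; rewrite /derivableC /dirC.
have reE : (fun w => complex.Re ((a +i* b)%C * f w + g w)) =
    (a *: (fun w => complex.Re (f w)) - b *: (fun w => complex.Im (f w)))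
    + (fun w => complex.Re (g w)).
  apply/funext => w; rewrite raddfD.
  by rewrite -[RHS]/((a * complex.Re (f w) - b * complex.Im (f w)) + _); case: (f w).
have imE : (fun w => complex.Im ((a +i* b)%C * f w + g w)) =
    (a *: (fun w => complex.Im (f w)) + b *: (fun w => complex.Re (f w)))
    + (fun w => complex.Im (g w)).
  apply/funext => w; rewrite raddfD.
  by rewrite -[RHS]/((a * complex.Im (f w) + b * complex.Re (f w)) + _); case: (f w).
have afr := derivableZ (k := a) fr; have afi := derivableZ (k := a) fi.
have bfr := derivableZ (k := b) fr; have bfi := derivableZ (k := b) fi.
have dr := derivableB afr bfi; have di := derivableD afi bfr.
rewrite reE imE; split; first exact: (conj (derivableD dr gr) (derivableD di gi)).
rewrite (deriveD dr gr) (deriveD di gi) (deriveB afr bfi) (deriveD afi bfr) !deriveZ //.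
Qed.

Lemma dirC_sum (T : Type) (r : seq T) (z : T -> R[i]) (f : T -> 'rV[R]_d -> R[i]) :
  (forall t, derivableC (f t)) ->
  derivableC (fun w => \sum_(t <- r) z t * f t w)
  /\ dirC (fun w => \sum_(t <- r) z t * f t w) h v = \sum_(t <- r) z t * dirC (f t) h v.
Proof.
move=> fd; elim: r => [|t r [rd rE]].
  under eq_fun do rewrite big_nil.
  split; first by split; exact: derivable_cst.
  by rewrite big_nil /dirC; apply/eqP; rewrite eq_complex /= !derive_cst !eqxx.
under eq_fun do rewrite big_cons.
by have [? ->] := derivableC_axpy (z t) (fd t) rd; rewrite big_cons rE.
Qed.

End DirectionalDerivative.

(** * Smooth covariant sections and their Weyl product *)

Section Sections.
Context {R : realType} {d : nat}.
Variables (M : manifold R d) (omega : chart M -> M -> 'M[R]_d).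
Local Open Scope complex_scope.

Lemma pdC_sum (c : chart M) i x (T : Type) (r : seq T) (z : T -> R[i]) (f : T -> M -> R[i]) :
  (forall t, smoothC_in c (f t)) -> chart_dom c x ->
  pdC c i (fun y => \sum_(t <- r) z t * f t y) x = \sum_(t <- r) z t * pdC c i (f t) x.
Proof.
move=> fc cx; have Ux : (chart_map c @` chart_dom c) (chart_map c x) by exists x.
have fd t : derivableC (delta_mx 0 i) (chart_map c x) (f t \o chart_inv c).
  have [fr fi] := fc t.
  exact: (conj ((fr [::] _ Ux).2 i) ((fi [::] _ Ux).2 i)).
exact: (dirC_sum r z fd).2.
Qed.

(** The conditions of [smooth_wsection] with the change of charts expressed by [ycov], the form that
    passes to Weyl products. *)
Definition good_wsection (a : wsection M) : Prop :=
  (forall c k J, smoothC_in c (fun x => a c x k J)) /\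
  (forall (c c' : chart M) (x : M) k n, chart_dom c x -> chart_dom c' x ->
     ycov (Defs.jacobian idfun c c' x) n (a c x k) (a c' x k)).

Lemma smooth_wsection_good a : smooth_wsection a -> good_wsection a.
Proof.
move=> [a_smooth a_cov]; split=> // c c' x k n cx c'x.
by apply: yeval_ycov => m y; exact: a_cov.
Qed.

(** Order 0 of [ycov] says that the value at [y = 0] is the same in all charts, so the chart
    [chart_at x], which varies with [x], can be replaced by a fixed one. *)
Lemma good_wsection_smooth a k : good_wsection a ->
  smoothC (fun x => a (chart_at x) x k [ffun=> 0%N]).
Proof.
move=> [a_smooth a_cov] c; apply: smoothC_in_eq (a_smooth c k [ffun=> 0%N]) => x cx.
exact: (a_cov c (chart_at x) x k 0%N cx (chart_atP x)).1.
Qed.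

Lemma smoothC_in_moyal (c : chart M) (P : M -> 'M[R]_d) n (p q : M -> yseries R d) J :
  (forall i j, smooth_in c (fun x => P x i j)) ->
  (forall J, smoothC_in c (fun x => p x J)) -> (forall J, smoothC_in c (fun x => q x J)) ->
  smoothC_in c (fun x => moyal (P x) n (p x) (q x) J).
Proof.
move=> Pc; elim: n p q J => [|n IHn] p q J pc qc /=.
  apply: (@smoothC_in_eq _ _ _ _ (fun x => \sum_(I <- mbox J) p x I * q x (msub J I))).
    by move=> x _; rewrite ymulE.
  by apply: smoothC_in_sum => I _; apply: smoothC_inM.
apply: smoothC_in_sum => i _; apply: smoothC_in_sum => j _.
apply: smoothC_inM; first exact: smoothC_in_real.
by apply: IHn => K; apply: smoothC_inM => //; exact: smoothC_in_cst.
Qed.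

(** Inverse of the transformation law of [omega]; the Jacobian is invertible as a factor of an
    invertible matrix. The result is the matrix that appears in [ycov_moyal]. *)
Lemma poisson_tensor_transform : symplectic_form omega ->
  forall (c c' : chart M) (x : M), chart_dom c x -> chart_dom c' x ->
    poisson_tensor omega c' x
    = (Defs.jacobian idfun c c' x)^T *m poisson_tensor omega c x *m Defs.jacobian idfun c c' x.
Proof.
move=> [_ transf _ omega_unit _] c c' x cx c'x; rewrite /poisson_tensor.
have := transf c c' x cx c'x; have := omega_unit c x cx.
move: (Defs.jacobian _ _ _ _) (omega c x) (omega c' x) (omega_unit c' x c'x) => A w w' w'u wu wE.
have Au : A \in unitmx by move: wu; rewrite wE !unitmx_mul => /andP [/andP [-> _] _].
apply: (can_inj (mulKmx w'u)); rewrite mulmxV //; apply: (can_inj (mulKmx Au)).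
by rewrite mulmx1 !mulmxA -wE mulmxV // mul1mx.
Qed.

Lemma good_wsection_mul a b : symplectic_form omega ->
  good_wsection a -> good_wsection b -> good_wsection (wsection_mul omega a b).
Proof.
move=> Homega [a_smooth a_cov] [b_smooth b_cov].
have [omega_smooth _ _ omega_unit _] := Homega; split=> [c k J|c c' x k n cx c'x].
  apply: (@smoothC_in_eq _ _ _ _ (fun x => \sum_(n < k.+1) \sum_(l < (k - n).+1)
      (2%:R ^+ n * n`!%:R)^-1
      * moyal (poisson_tensor omega c x) n (a c x l) (b c x (k - n - l)%N) J)).
    by move=> x _; rewrite /wsection_mul wmulE.
  apply: smoothC_in_sum => n _; apply: smoothC_in_sum => l _.
  apply: smoothC_inM; first exact: smoothC_in_cst.
  apply: smoothC_in_moyal => // i j.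
  rewrite /poisson_tensor; apply: smooth_in_invmx => [k' l'|x cx].
    exact: omega_smooth.
  exact: omega_unit.
rewrite /wsection_mul.
have wmulE1 P (f g : weyl R d) : wmul P f g k = fun J => \sum_(n < k.+1) 1 *
   (\sum_(l < (k - n).+1) (2%:R ^+ n * n`!%:R)^-1 * moyal P n (f l) (g (k - n - l)%N) J).
  by apply/funext => J; rewrite wmulE; apply: eq_bigr => m _; rewrite mul1r.
rewrite !wmulE1; apply: ycov_sum => m; apply: ycov_sum => l.
rewrite (poisson_tensor_transform Homega cx c'x).
by apply: ycov_moyal => m'; [exact: a_cov | exact: b_cov].
Qed.

End Sections.

(** * Flat sections *)

Section Flat.
Context {R : realType} {d : nat}.
Variables (M : manifold R d) (omega : chart M -> M -> 'M[R]_d).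
Variables (Gamma : christoffel M) (gamma : woneform M).
Local Open Scope complex_scope.

Lemma ytimes_sum i (T : Type) (r : seq T) (z : T -> R[i]) (p : T -> yseries R d) :
  ytimes i (fun J => \sum_(t <- r) z t * p t J)
  = fun J => \sum_(t <- r) z t * ytimes i (p t) J.
Proof.
apply/funext => J; rewrite /ytimes; case: ltnP => // _.
by rewrite big1 // => t _; rewrite mulr0.
Qed.

Lemma yeval_sum m (T : Type) (r : seq T) (z : T -> R[i]) (p : T -> yseries R d) y :
  yeval m (fun J => \sum_(t <- r) z t * p t J) y = \sum_(t <- r) z t * yeval m (p t) y.
Proof.
rewrite yevalE; under eq_bigr do rewrite mulr_suml.
rewrite exchange_big; apply: eq_bigr => t _ /=.
by rewrite yevalE mulr_sumr; apply: eq_bigr => J _; rewrite mulrA.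
Qed.

Lemma wcomm_sumr P (g : weyl R d) (T : Type) (r : seq T) (z : T -> R[i])
    (a : T -> weyl R d) k J :
  wcomm P g (fun k J => \sum_(t <- r) z t * a t k J) k J
  = \sum_(t <- r) z t * wcomm P g (a t) k J.
Proof.
rewrite /wcomm /wsub wmul_suml wmul_sumr -sumrB.
by apply: eq_bigr => t _; rewrite mulrBr.
Qed.

Lemma wcomm_scaler P (g a : weyl R d) (z : fps R[i]) :
  wcomm P g (wscale z a) = wscale z (wcomm P g a).
Proof.
apply/funext => k; apply/funext => J.
rewrite /wcomm /wsub wmul_scalel wmul_scaler -sumrB.
by apply: eq_bigr => t _; rewrite mulrBr.
Qed.

(* The terms [- delta + d] of the Fedosov connection, which do not mix orders
   in lambda. *)
Definition fedosov_order0 (c : chart M) x i (p : M -> yseries R d) : yseries R d :=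
  fun J => - ydiff i (p x) J + (pdC c i (fun y => p y J) x
    - \sum_l \sum_j (Gamma c x l i j)%:C * ytimes j (ydiff l (p x)) J).

Lemma fedosov_order0_sum c x i (T : Type) (r : seq T) (z : T -> R[i])
    (p : T -> M -> yseries R d) J :
  (forall t J, smoothC_in c (fun y => p t y J)) -> chart_dom c x ->
  fedosov_order0 c x i (fun y J => \sum_(t <- r) z t * p t y J) J
  = \sum_(t <- r) z t * fedosov_order0 c x i (p t) J.
Proof.
move=> pc cx; rewrite /fedosov_order0 pdC_sum // ydiff_sum.
have -> : \sum_l \sum_j (Gamma c x l i j)%:C *
      ytimes j (ydiff l (fun J => \sum_(t <- r) z t * p t x J)) J
    = \sum_(t <- r) z t * \sum_l \sum_j (Gamma c x l i j)%:C * ytimes j (ydiff l (p t x)) J.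
  under [RHS]eq_bigr do rewrite mulr_sumr.
  rewrite [RHS]exchange_big; apply: eq_bigr => l _ /=.
  under [RHS]eq_bigr do rewrite mulr_sumr.
  rewrite [RHS]exchange_big; apply: eq_bigr => j _ /=.
  rewrite ydiff_sum ytimes_sum mulr_sumr.
  by apply: eq_bigr => t _; rewrite mulrCA.
rewrite -sumrN -sumrB -big_split /=; apply: eq_bigr => t _.
by rewrite !mulrDr !mulrN.
Qed.

Lemma flat_wsection_sum (T : Type) (r : seq T) (z : T -> R[i]) (a : T -> wsection M) :
  (forall t, flat_wsection omega Gamma gamma (a t)) ->
  flat_wsection omega Gamma gamma (fun c x k J => \sum_(t <- r) z t * a t c x k J).
Proof.
move=> a_flat; split.
  split=> [c k J|c c' x k m y cx c'x].
    apply: smoothC_in_sum => t _; apply: smoothC_inM; first exact: smoothC_in_cst.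
    exact: (a_flat t).1.1.
  rewrite !yeval_sum; apply: eq_bigr => t _; congr (_ * _).
  exact: (a_flat t).1.2.
move=> c x i k J cx.
(* Division by lambda reads the commutator at order [k + 1], while the other terms stay at order
   [k]. *)
rewrite -[LHS]/(fedosov_order0 c x i (fun y J => \sum_(t <- r) z t * a t c y k J) J
  - wcomm (poisson_tensor omega c x) (gamma c x i)
      (fun k J => \sum_(t <- r) z t * a t c x k J) k.+1 J).
rewrite fedosov_order0_sum // => [|t K]; last exact: (a_flat t).1.1.
rewrite wcomm_sumr -sumrB big1 // => t _; rewrite -mulrBr.
by have := (a_flat t).2 c x i k J cx => /(congr1 ( *%R (z t))); rewrite mulr0.
Qed.

Lemma flat_wsection_scale (z : fps R[i]) (a : wsection M) :
  flat_wsection omega Gamma gamma a ->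
  flat_wsection omega Gamma gamma (fun c x => wscale z (a c x)).
Proof.
move=> [[a_smooth a_cov] a_flat]; split.
  split=> [c k J|c c' x k m y cx c'x].
    apply: smoothC_in_sum => t _; apply: smoothC_inM; first exact: smoothC_in_cst.
    exact: a_smooth.
  rewrite !yeval_sum; apply: eq_bigr => t _; congr (_ * _).
  exact: a_cov.
move=> c x i k J cx.
rewrite -[LHS]/(fedosov_order0 c x i
    (fun y J => \sum_(t < k.+1) z t * a c y (k - t)%N J) J
  - wcomm (poisson_tensor omega c x) (gamma c x i) (wscale z (a c x)) k.+1 J).
rewrite fedosov_order0_sum //.
(* The commutator has no term of order 0 in lambda, hence the division by
   lambda is compatible with the multiplication by [z]. *)
rewrite wcomm_scaler /wscale [X in _ - X]big_ord_recr /= subnn wcomm0 mulr0 addr0.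
rewrite -sumrB big1 // => t _; rewrite -mulrBr subSn; last by rewrite -ltnS.
by have := a_flat c x i (k - t)%N J cx => /(congr1 ( *%R (z t))); rewrite mulr0.
Qed.

End Flat.

(** * Polynomial dependence on alpha *)

Section PolynomialSections.
Context {R : realType} {d n : nat}.
Variables (M : manifold R d) (omega : chart M -> M -> 'M[R]_d).
Hypothesis Homega : symplectic_form omega.
Local Open Scope complex_scope.
Implicit Types (alpha : 'I_n -> fps R[i]) (ts us : seq (wsection M * seq ('I_n * nat))).

Lemma ycov_scale_wone (A : 'M[R]_d) m (z : R[i]) k :
  ycov A m (fun J => z * wone k J) (fun J => z * wone k J).
Proof.
case: k => [|k].
  rewrite (_ : (fun J => _) = yconst z); first exact: ycov_const.
  by apply/funext => J; rewrite /= /yconst; case: eqP; rewrite ?mulr1 ?mulr0.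
rewrite (_ : (fun J => _) = fun=> 0); first exact: ycov0.
by apply/funext => J; rewrite mulr0.
Qed.

Definition wsection_one : wsection M := fun c x => wone.

Lemma good_wsection_one : good_wsection wsection_one.
Proof.
split=> [c k J|c c' x k m _ _]; first exact: smoothC_in_cst.
have := ycov_scale_wone (Defs.jacobian idfun c c' x) m 1 k.
by under eq_fun do rewrite mul1r.
Qed.

(* [lambda^i b], with the coefficient of [lambda^0 y^0] removed: it has positive
   Weyl degree. *)
Definition shift_reduced (b : wsection M) i : wsection M := fun c x k J =>
  (if (i <= k)%N then b c x (k - i)%N J else 0)
  + (- ((i == 0%N)%:R * b c x 0%N [ffun=> 0%N])) * wone k J.

Lemma good_shift_reduced b i : good_wsection b -> good_wsection (shift_reduced b i).
Proof.
move=> [b_smooth b_cov]; split=> [c k J|c c' x k m cx c'x].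
  apply: smoothC_inD.
    by case: leqP => _; [exact: b_smooth | exact: smoothC_in_cst].
  apply: smoothC_inM; last exact: smoothC_in_cst.
  apply: (@smoothC_in_eq _ _ _ _
    (fun x => (-1) * ((i == 0%N)%:R * b c x 0%N [ffun=> 0%N]))).
    by move=> x _; rewrite mulN1r.
  apply: smoothC_inM; first exact: smoothC_in_cst.
  by apply: smoothC_inM; [exact: smoothC_in_cst | exact: b_smooth].
(* The subtracted coefficient agrees in both charts, so subtracting it preserves covariance. *)
have [b0 _] := b_cov c c' x 0%N 0%N cx c'x.
apply: ycovD; last by rewrite b0; exact: ycov_scale_wone.
by case: leqP => _; [exact: b_cov | exact: ycov0].
Qed.

(* A list of pairs of a section and a monomial in the [alpha l k] stands for a
   section depending polynomially on [alpha]. *)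
Definition wterms_eval ts alpha : wsection M := fun c x k J =>
  \sum_(t <- ts) (\prod_(lk <- t.2) alpha lk.1 lk.2) * t.1 c x k J.

Definition wterms_mul ts us : seq (wsection M * seq ('I_n * nat)) :=
  [seq (wsection_mul omega t.1 u.1, t.2 ++ u.2) | t <- ts, u <- us].

Lemma wterms_mul_eval ts us alpha c x :
  wterms_eval (wterms_mul ts us) alpha c x
  = wmul (poisson_tensor omega c x) (wterms_eval ts alpha c x) (wterms_eval us alpha c x).
Proof.
rewrite /wterms_eval wmul_suml; apply/funext => k; apply/funext => J.
rewrite /wterms_mul big_allpairs_dep; apply: eq_bigr => t _ /=.
rewrite wmul_sumr mulr_sumr; apply: eq_bigr => u _.
by rewrite big_cat /= mulrA.
Qed.

Variable b : 'I_n -> wsection M.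
Hypothesis b_good : forall l, good_wsection (b l).

(** Modulo lambda^(K+1), these are the terms of the section with its constant removed, as a linear
    form in the [alpha l i]; larger [i] only affect higher orders. *)
Definition generators K : seq (wsection M * seq ('I_n * nat)) :=
  [seq (shift_reduced (b l) i, [:: (l, i)]) | l <- enum 'I_n, i <- iota 0 K.+1].

Definition wterms_pow K m :=
  iter m (wterms_mul (generators K)) [:: (wsection_one, [::])].

Inductive all_good : seq (wsection M * seq ('I_n * nat)) -> Prop :=
| all_good_nil : all_good [::]
| all_good_cons t ts : good_wsection t.1 -> all_good ts -> all_good (t :: ts).

Lemma all_good_cat ts us : all_good ts -> all_good us -> all_good (ts ++ us).
Proof. by move=> gts gus; elim: gts => //= t ts' gt _; exact: all_good_cons. Qed.

Lemma all_good_map (T : Type) (r : seq T) (f : T -> wsection M * seq ('I_n * nat)) :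
  (forall t, good_wsection (f t).1) -> all_good (map f r).
Proof.
by move=> fg; elim: r => [|t r IHr] /=; [exact: all_good_nil | exact: all_good_cons].
Qed.

Lemma all_good_mul ts us : all_good ts -> all_good us -> all_good (wterms_mul ts us).
Proof.
move=> gts gus; elim: gts => [|t ts' gt _ IHts]; first exact: all_good_nil.
rewrite /wterms_mul /=; apply: all_good_cat IHts.
elim: gus => [|u us' gu _ IHus] /=; first exact: all_good_nil.
by apply: all_good_cons => //=; exact: good_wsection_mul.
Qed.

Lemma all_good_generators K : all_good (generators K).
Proof.
rewrite /generators; elim: (enum 'I_n) => [|l r IHr]; first exact: all_good_nil.
by apply: all_good_cat IHr; apply: all_good_map => i; exact: good_shift_reduced.
Qed.

Lemma all_good_pow K m : all_good (wterms_pow K m).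
Proof.
elim: m => [|m IHm]; first by apply: all_good_cons all_good_nil; exact: good_wsection_one.
by apply: all_good_mul IHm; exact: all_good_generators.
Qed.

Lemma generators_eval K alpha c x k J : (k <= K)%N ->
  wterms_eval (generators K) alpha c x k J
  = \sum_l \sum_(i < k.+1) alpha l i * b l c x (k - i)%N J
    - (\sum_l alpha l 0%N * b l c x 0%N [ffun=> 0%N]) * wone k J.
Proof.
move=> kK; rewrite /wterms_eval /generators big_allpairs_dep big_enum mulr_suml -sumrB.
apply: eq_bigr => l _.
rewrite -[iota 0 K.+1]/(index_iota 0 K.+1) big_mkord.
under eq_bigr do rewrite big_seq1 /shift_reduced mulrDr.
rewrite big_split /=; congr (_ + _).
  rewrite (big_ord_widen K.+1 (fun i => alpha l i * b l c x (k - i)%N J)) //.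
  rewrite [RHS]big_mkcond; apply: eq_bigr => i _; rewrite ltnS.
  by case: leqP => _ //; rewrite mulr0.
rewrite big_ord_recl /= big1 ?addr0 => [|i _]; last by rewrite mul0r oppr0 mul0r mulr0.
by rewrite mul1r mulNr mulrN mulrA.
Qed.

(** Coefficients of a Weyl product up to order [K] depend only on those of the factors up to order
    [K], so truncating the generators is harmless. *)
Lemma wterms_pow_eval K alpha c x (a : weyl R d) m k J :
  (forall l, (l <= K)%N -> wterms_eval (generators K) alpha c x l = a l) ->
  (k <= K)%N ->
  wterms_eval (wterms_pow K m) alpha c x k J = wpow (poisson_tensor omega c x) a m k J.
Proof.
move=> aE; elim: m k J => [|m IHm] k J kK.
  by rewrite /wterms_eval big_seq1 big_nil mul1r.
rewrite /wterms_pow iterS -/(wterms_pow K m) wterms_mul_eval.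
apply: eq_wmul => l lk; first exact: aE (leq_trans lk kK).
by apply/funext => I; exact: IHm (leq_trans lk kK).
Qed.

(** The exponential series of the reduced section at lambda^K y^0, cut after [m = 2 K]: this
    monomial has degree [2 K], and the [m]-th power has degree at least [m]. *)
Definition exp_poly K : fun_poly M n :=
  [seq ((fun x => (u.1`!%:R)^-1 * u.2.1 (chart_at x) x K [ffun=> 0%N]), u.2.2)
     | u <- [seq (m, t) | m <- iota 0 (2 * K).+1, t <- wterms_pow K m]].

Lemma exp_poly_smooth K : smooth_fun_poly (exp_poly K).
Proof.
rewrite /exp_poly; elim: (iota _ _) => [|m r IHr] //= t.
rewrite map_cat mem_cat => /orP [|/IHr //].
elim: (all_good_pow K m) t => [|u us gu _ IHus] //= t.
rewrite inE => /predU1P [-> c /=|/IHus //].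
apply: smoothC_inM; first exact: smoothC_in_cst.
exact: good_wsection_smooth.
Qed.

Lemma exp_poly_eval K alpha x :
  fun_poly_eval (exp_poly K) alpha x
  = \sum_(m < (2 * K).+1) (m`!%:R)^-1
      * wterms_eval (wterms_pow K m) alpha (chart_at x) x K [ffun=> 0%N].
Proof.
rewrite /fun_poly_eval /exp_poly big_map big_allpairs_dep.
rewrite -[iota _ _]/(index_iota 0 (2 * K).+1) big_mkord; apply: eq_bigr => m _.
rewrite /wterms_eval mulr_sumr; apply: eq_bigr => t _ /=.
by rewrite -mulrA; congr (_ * _); rewrite mulrC.
Qed.

End PolynomialSections.

(** * The expansion of the star exponential *)

Theorem corollary3p2 (R : realType) (d n : nat)
  (M : manifold R d) (omega : chart M -> M -> 'M[R]_d)
  (Homega : symplectic_form omega)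
  (G : lie_group R n) (act : G -> M -> M) (Hact : symplectic_action omega act)
  (C : nat -> (M -> R[i]) -> (M -> R[i]) -> M -> R[i])
  (HC : star_product omega C) (Hinv : invariant_star act C)
  (Gamma : christoffel M) (gamma : woneform M) (Q : formal_fun M -> wsection M)
  (HF : fedosov_type omega Gamma gamma Q C)
  (U : algType (fps R[i])) (iota : {linear glambda R n -> U})
  (HU : universal_enveloping G iota)
  (Phi : U -> formal_fun M) (HPhi : quantum_moment_map act C iota Phi)
  (X : n.-tuple 'rV[R]_n) (HX : basis_of fullv X) :
  let Phi0 xi := Phi (iota (glambda_of xi)) 0%N in
  let PhiX (alpha : 'I_n -> fps R[i]) :=
    Phi (iota (\sum_l alpha l *: glambda_of (tnth X l))) in
  exists P : nat -> fun_poly M n,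
    (forall j, smooth_fun_poly (P j)) /\
    forall alpha : 'I_n -> fps R[i],
      (* the series defining the star exponential converges *)
      (forall c x k J, chart_dom c x ->
         cvgn (wexp_sum omega (Q (PhiX alpha)) c x k J)) /\
      forall j x,
        star_exp omega Q (PhiX alpha) j x
        = cexp (\sum_l alpha l 0%N * Phi0 (tnth X l) x)
          * fun_poly_eval (P j) alpha x.
Proof.
move=> Phi0 PhiX.
have [_ [QP sigmaP] _] := HF; have [Phi_smooth [PhiD PhiZ] _ _ _] := HPhi.
pose b l := Q (Phi (iota (glambda_of (tnth X l)))).
have b_flat l : flat_wsection omega Gamma gamma (b l) by exact: (QP _ (Phi_smooth _)).1.
have sigma_b l : sigma (b l) = Phi (iota (glambda_of (tnth X l))).
  exact: (QP _ (Phi_smooth _)).2.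
have b_good l : good_wsection (b l) by exact: smooth_wsection_good (b_flat l).1.
(* The factor [1] gives the sum the shape expected by [flat_wsection_sum]. *)
pose B alpha : wsection M := fun c x k J => \sum_l 1 * wscale (alpha l) (b l c x) k J.
have Phi_sum (r : seq 'I_n) (z : 'I_n -> fps R[i]) u k x :
    Phi (\sum_(l <- r) z l *: u l) k x = \sum_(l <- r) formal_scale (z l) (Phi (u l)) k x.
  elim: r => [|l r IHr].
    rewrite !big_nil -(scale0r 1) PhiZ /formal_scale big1 // => i _.
    by rewrite mul0r.
  by rewrite !big_cons PhiD PhiZ /formal_add IHr.
have QPhiX alpha c x : chart_dom c x -> Q (PhiX alpha) c x = B alpha c x.
  (* [B alpha] is flat, so [Q] recovers it from its value at [y = 0]; it remains to identify that
     value. *)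
  have -> : PhiX alpha = sigma (B alpha).
    apply/funext => k; apply/funext => x0.
    rewrite /PhiX linear_sum; under eq_bigr do rewrite linearZ.
    rewrite Phi_sum; apply: eq_bigr => l _; rewrite mul1r; apply: eq_bigr => i _.
    by rewrite -sigma_b.
  apply: (sigmaP _ _).2; apply: flat_wsection_sum => l; exact: flat_wsection_scale.
pose z alpha c x : R[i] := \sum_l alpha l 0%N * b l c x 0%N [ffun=> 0%N].
pose a alpha c x : weyl R d := fun k J => B alpha c x k J - z alpha c x * wone k J.
have a_filt alpha c x : wfilt 1 (a alpha c x).
  (* Degree below 1 leaves only lambda^0 y^0, the coefficient removed by [z]. *)
  case=> // J; rewrite muln0 ltnS leqn0 mdeg_eq0 => /eqP ->.
  rewrite /a /B /= /yconst mdeg0 eqxx mulr1 -sumrB big1 // => l _.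
  by rewrite /wscale big_ord1 mul1r subrr.
have B_split alpha c x : B alpha c x = fun k J => z alpha c x * wone k J + a alpha c x k J.
  by apply/funext => k; apply/funext => J; rewrite addrC subrK.
have cvgB alpha c x k J : chart_dom c x ->
    wexp_sum omega (Q (PhiX alpha)) c x k J @ \oo -->
    (cexp (z alpha c x) * \sum_(m < (2 * k + mdeg J).+1) (m`!%:R)^-1
       * wpow (poisson_tensor omega c x) (a alpha c x) m k J : R[i]^o).
  move=> cx; rewrite /wexp_sum QPhiX // B_split; exact: wexp_cvg.
exists (exp_poly omega b); split=> [K|alpha]; first exact: exp_poly_smooth.
split=> [c x k J cx|K x]; first exact: cvgP (cvgB alpha c x k J cx).
rewrite /star_exp /sigma /wexp.
have /(cvg_lim (@norm_hausdorff _ R[i]^o)) -> :=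
  cvgB alpha (chart_at x) x K [ffun=> 0%N] (chart_atP x).
have -> : \sum_l alpha l 0%N * Phi0 (tnth X l) x = z alpha (chart_at x) x.
  by apply: eq_bigr => l _; rewrite /Phi0 -sigma_b.
(* At [y = 0] the bound [2 K + mdeg J] becomes the [2 K] of [exp_poly]. *)
rewrite mdeg0 addn0 exp_poly_eval; congr (_ * _).
apply: eq_bigr => m _; congr (_ * _); apply/esym/wterms_pow_eval => // k kK.
apply/funext => J; rewrite generators_eval //; congr (_ - _).
by apply: eq_bigr => l _; rewrite mul1r.
Qed.
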